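(* Let $k$ be a positive integer and let $z\in\mathbb{C}$ with $\Re(z)\ge 0$ and $z\ne 0$. Then $$\left|\frac{\widehat{R}_{k+1}(z)}{\widehat{T}_k(z)}\right| < \eta_k\sqrt{\pi k}.$$
   Context: $\log$ is the principal branch of the logarithm on $\mathbb{C}\setminus(-\infty,0]$. $\ln\Gamma$ denotes the analytic function on $\mathbb{C}\setminus(-\infty,0]$ with $\exp(\ln\Gamma(z))=\Gamma(z)$ that is real and equal to $\log(\Gamma(x))$ for real $x>0$. $B_{2j}(u)$ is the Bernoulli polynomial and $B_{2j}=B_{2j}(0)$ the Bernoulli number. For integers $k\ge1$, $\eta_k = 1/(1-2^{1-2k})$. For integers $j\ge 1$, $$\widehat{T}_j(z) = \frac{B_{2j}(\frac12)}{2j(2j-1)z^{2j-1}} = -\frac{(1-2^{1-2j})B_{2j}}{2j(2j-1)z^{2j-1}},$$ and for integers $k\ge 1$ the remainder $\widehat{R}_k(z)$ is defined by $$\ln\Gamma(z+\tfrac12) = z\log z - z + \tfrac12\log(2\pi) + \sum_{j=1}^{k-1}\widehat{T}_j(z) + \widehat{R}_k(z).$$ *)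

(* Defs.v *)
From Stdlib Require Import Reals ZArith Arith.
From Coquelicot Require Import Coquelicot.

Open Scope R_scope.

Definition Cexp (z : C) : C :=
  (exp (Re z) * cos (Im z), exp (Re z) * sin (Im z)).

(* Principal argument, with values in (-PI, PI]. *)
Definition Carg (z : C) : R :=
  if Rle_dec 0 (Im z) then acos (Re z / Cmod z) else - acos (Re z / Cmod z).

Definition Clog (z : C) : C := (ln (Cmod z), Carg z).

Definition slit_plane (z : C) : Prop := ~ (Im z = 0 /\ Re z <= 0).

(* z (z + 1) ... (z + n - 1) *)
Fixpoint Crising (z : C) (n : nat) : C :=
  match n with
  | O => RtoC 1
  | S m => (Crising z m * (z + RtoC (INR m)))%C
  end.

(* n! n^z / (z (z + 1) ... (z + n)), where n^z = exp (z ln n) *)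
Definition Gamma_seq (z : C) (n : nat) : C :=
  (RtoC (INR (fact n)) * Cexp (z * RtoC (ln (INR n))) / Crising z (S n))%C.

(* Gauss's limit formula for the Gamma function; the sequence converges for
   every z outside {0, -1, -2, ...}, and the value is meaningless elsewhere. *)
Definition CGamma (z : C) : C :=
  (real (Lim_seq (fun n => Re (Gamma_seq z n))),
   real (Lim_seq (fun n => Im (Gamma_seq z n)))).

(* The three clauses determine L uniquely on the slit plane, which is
   connected; its values on the cut are unconstrained. *)
Definition is_lnGamma (L : C -> C) : Prop :=
  (forall z : C, slit_plane z ->
     ex_derive (K := C_AbsRing) (V := C_NormedModule) L z) /\
  (forall z : C, slit_plane z -> Cexp (L z) = CGamma z) /\
  (forall x : R, 0 < x ->
     Im (L (RtoC x)) = 0 /\ L (RtoC x) = Clog (CGamma (RtoC x))).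

(* bernoulli_upto n i = B_i for i <= n, from
   sum_(0 <= i <= m) binomial(m + 1, i) B_i = 0 for m >= 1. *)
Fixpoint bernoulli_upto (n : nat) : nat -> R :=
  match n with
  | O => fun _ => 1
  | S m => fun i =>
      if Nat.eqb i (S m)
      then - / INR (m + 2) *
           sum_f_R0 (fun l => Binomial.C (m + 2) l * bernoulli_upto m l) m
      else bernoulli_upto m i
  end.

Definition bernoulli (n : nat) : R := bernoulli_upto n n.

Definition bernoulli_poly (n : nat) (u : R) : R :=
  sum_f_R0 (fun l => Binomial.C n l * bernoulli l * u ^ (n - l)) n.

Definition eta (k : nat) : R := 1 / (1 - powerRZ 2 (1 - 2 * Z.of_nat k)).

Definition That (j : nat) (z : C) : C :=
  (RtoC (bernoulli_poly (2 * j) (1 / 2)) /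
   (RtoC (INR (2 * j)) * RtoC (INR (2 * j - 1)) * z ^ (2 * j - 1)))%C.

(* L plays the role of ln Gamma; the sum is empty for k = 1. *)
Definition Rhat (L : C -> C) (k : nat) (z : C) : C :=
  (L (z + RtoC (1 / 2)) -
   (z * Clog z - z + RtoC (1 / 2) * Clog (RtoC (2 * PI)) +
    sum_n_m (G := C_AbelianMonoid) (fun j => That j z) 1 (k - 1)))%C.

(* Main.v *)
Require Import Defs.
From Stdlib Require Import Reals.
From Coquelicot Require Import Coquelicot.
From Stdlib Require Import ZArith Arith Lra Lia Ranalysis5.

Open Scope R_scope.

(** The remainder has an integral form that is easy to bound. Summing log (z + m + 1/2)
    over m by the midpoint Euler-Maclaurin formula, and letting Gauss's product for
    Gamma (z + 1/2) tend to its limit, one finds that the remainder after the term of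
    index k is the integral over u >= 0 of - B_2k({u + 1/2}) / (2k (z + u)^(2k)).

    On [0, 1] one has |B_2k(u)| <= |B_2k| ([bern_even_bound]), and Re z >= 0 gives
    |z + u|^2 >= |z|^2 + u^2. So the remainder is at most
    |B_2k| / (2k) |z|^(1-2k) times the integral of (1 + u^2)^(-k) ([em_remainder_bound]).
    That integral is PI/2 times a Wallis product. After division by the modulus of the
    last term kept, with |B_2k(1/2)| = |B_2k| / eta_k, there remains
    eta_k sqrt PI Gamma (k + 1/2) / Gamma k ([remainder_bound_That]), and the strict
    bound Gamma (k + 1/2) / Gamma k < sqrt k is the inequality between consecutive
    Wallis integrals ([wallis_sqrt_bound]).

    The integral is never formed. The Euler-Maclaurin remainder up to n is defined by
    its boundary terms, each step is estimated by a mean value inequality for complex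
    functions of a real variable ([Cmean_value]), and the remainder is the limit of
    these quantities, which converge at the rate 1/n uniformly in z
    ([em_remainder_cauchy]). The constant ln (2 PI) / 2 of the expansion is found at
    z = 1/2, where the sum of logarithms is that of a factorial, by Wallis's product
    ([stirling_limit]), and carried to other z by a bound of the derivative in z
    ([stirling_part_variation]).

    All this determines Gamma (z + 1/2), hence its logarithm up to multiples of
    2 PI i. The multiple is 0 on the positive real axis, and it is followed along a
    segment to z by comparing the given logarithm with that of one Gauss product of
    large index ([lnGamma_expansion]). *)

Local Notation bern := bernoulli_poly.

(** * Bernoulli polynomials *)

Lemma bernoulli_upto_stable n i : (i <= n)%nat -> bernoulli_upto n i = bernoulli i.
Proof.
  intros H; induction n as [|n IH].
  - replace i with 0%nat by lia; reflexivity.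
  - destruct (Nat.eq_dec i (S n)) as [->|Hn]; [reflexivity|].
    simpl; rewrite (proj2 (Nat.eqb_neq _ _) Hn); apply IH; lia.
Qed.

(** The recurrence that defines the Bernoulli numbers, with the term of highest index
    moved to the other side. *)
Lemma bernoulli_rec m :
  sum_f_R0 (fun l => Binomial.C (m + 2) l * bernoulli l) (S m) = 0.
Proof.
  rewrite tech5.
  assert (E : bernoulli (S m) = - / INR (m + 2) *
     sum_f_R0 (fun l => Binomial.C (m + 2) l * bernoulli l) m).
  { unfold bernoulli at 1; simpl bernoulli_upto at 1; rewrite Nat.eqb_refl.
    f_equal; apply sum_eq; intros l Hl; now rewrite bernoulli_upto_stable. }
  rewrite E.
  assert (Hc : Binomial.C (m + 2) (S m) = INR (m + 2)).
  { rewrite pascal_step1 by lia; replace (m + 2 - S m)%nat with 1%nat by lia.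
    unfold Binomial.C; replace (m + 2)%nat with (S (S m)) by lia.
    replace (S (S m) - 1)%nat with (S m) by lia.
    rewrite (fact_simpl (S m)), mult_INR; simpl (fact 1); simpl (INR 1).
    field; apply INR_fact_neq_0. }
  rewrite Hc; field; apply not_0_INR; lia.
Qed.

Lemma bern_0 n : bern n 0 = bernoulli n.
Proof.
  unfold bernoulli_poly; destruct n as [|n].
  - simpl; unfold Binomial.C; simpl; field.
  - rewrite tech5, Nat.sub_diag.
    rewrite (sum_eq _ (fun _ => 0)).
    + rewrite sum_cte; unfold Binomial.C; rewrite Nat.sub_diag; simpl (fact 0); simpl (INR 1); simpl (0 ^ 0).
      field; apply INR_fact_neq_0.
    + intros l Hl; rewrite pow_i by lia; ring.
Qed.

Lemma bern_1 n : (2 <= n)%nat -> bern n 1 = bern n 0.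
Proof.
  intros Hn; rewrite bern_0; unfold bernoulli_poly.
  destruct n as [|[|m]]; try lia.
  rewrite tech5, Nat.sub_diag.
  rewrite (sum_eq _ (fun l => Binomial.C (m + 2) l * bernoulli l)).
  - rewrite bernoulli_rec.
    unfold Binomial.C; rewrite Nat.sub_diag; simpl (fact 0); simpl (1 ^ 0); simpl (INR 1).
    field; apply INR_fact_neq_0.
  - intros l Hl; rewrite pow1; replace (m + 2)%nat with (S (S m)) by lia; ring.
Qed.

Lemma bern_deg0 u : bern 0 u = 1.
Proof. unfold bernoulli_poly, bernoulli; simpl; unfold Binomial.C; simpl; field. Qed.

Lemma bern_deg1 u : bern 1 u = u - 1 / 2.
Proof.
  unfold bernoulli_poly, bernoulli; simpl; unfold Binomial.C; simpl; field.
Qed.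

Lemma is_derive_sum_f_R0 (f : nat -> R -> R) (df : nat -> R) n u :
  (forall l, (l <= n)%nat -> is_derive (f l) u (df l)) ->
  is_derive (fun t => sum_f_R0 (fun l => f l t) n) u (sum_f_R0 df n).
Proof.
  induction n as [|n IH]; intros H.
  - now apply H.
  - apply (is_derive_plus (K := R_AbsRing) (V := R_NormedModule)
             (fun t => sum_f_R0 (fun l => f l t) n) (f (S n))).
    + apply IH; intros l Hl; apply H; lia.
    + now apply H.
Qed.

Lemma is_derive_bern n u : is_derive (bern (S n)) u (INR (S n) * bern n u).
Proof.
  assert (H := is_derive_sum_f_R0
    (fun l t => Binomial.C (S n) l * bernoulli l * t ^ (S n - l))
    (fun l => Binomial.C (S n) l * bernoulli l * (INR (S n - l) * u ^ (S n - l - 1)))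
    (S n) u).
  unfold bernoulli_poly.
  replace (INR (S n) * _) with (sum_f_R0
    (fun l => Binomial.C (S n) l * bernoulli l * (INR (S n - l) * u ^ (S n - l - 1)))
    (S n)).
  - apply H; intros l Hl; auto_derive; [trivial|].
    change (match l with 0%nat => S n | S l0 => (n - l0)%nat end) with (S n - l)%nat.
    rewrite <- Nat.sub_1_r; ring.
  - rewrite tech5, Nat.sub_diag, scal_sum; simpl (INR 0).
    rewrite Rmult_0_l, Rmult_0_r, Rplus_0_r.
    apply sum_eq; intros l Hl.
    assert (E : Binomial.C (S n) l * INR (S n - l) = INR (S n) * Binomial.C n l).
    { unfold Binomial.C; replace (S n - l)%nat with (S (n - l)) by lia.
      rewrite !fact_simpl, !mult_INR; field.
      repeat split; try apply INR_fact_neq_0; apply not_0_INR; lia. }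
    replace (S n - l - 1)%nat with (n - l)%nat by lia.
    transitivity ((Binomial.C (S n) l * INR (S n - l)) * bernoulli l * u ^ (n - l)); [ring|].
    rewrite E; ring.
Qed.

Lemma is_derive_continuity_pt (f : R -> R) u l : is_derive f u l -> continuity_pt f u.
Proof.
  intros H; apply derivable_continuous_pt; exists l; now apply is_derive_Reals.
Qed.

Lemma derive_zero_const (f : R -> R) :
  (forall u, is_derive f u 0) -> forall a b, f a = f b.
Proof.
  intros H a b.
  destruct (MVT_gen f a b (fun _ => 0)) as [c [_ Hc]].
  - intros; apply H.
  - intros x _; exact (is_derive_continuity_pt f x 0 (H x)).
  - lra.
Qed.

(** The derivatives fix each member of the sequence up to a constant, and periodicity of
    the next member fixes that constant. All the symmetries below are instances: the
    transformed sequence satisfies the same three conditions. *)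
Lemma bern_unique (P : nat -> R -> R) :
  (forall u, P 0%nat u = 1) ->
  (forall n u, is_derive (P (S n)) u (INR (S n) * P n u)) ->
  (forall n, (2 <= n)%nat -> P n 1 = P n 0) ->
  forall n u, P n u = bern n u.
Proof.
  intros P0 dP P1.
  assert (Hstep : forall n, (forall u, P n u = bern n u) ->
            forall u, P (S n) u = bern (S n) u).
  { intros n IH.
    set (c := P (S n) 0 - bern (S n) 0).
    assert (Hc : forall u, P (S n) u - bern (S n) u = c).
    { intros u; apply (derive_zero_const (fun u => P (S n) u - bern (S n) u)).
      intros t; evar_last.
      - apply (is_derive_minus (K := R_AbsRing) (V := R_NormedModule)); [apply dP | apply is_derive_bern].
      - unfold minus, plus, opp; simpl; rewrite IH; ring. }
    assert (Hd : forall u, P (S (S n)) u - bern (S (S n)) u - INR (S (S n)) * c * u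
                 = P (S (S n)) 0 - bern (S (S n)) 0 - INR (S (S n)) * c * 0).
    { intros u; apply (derive_zero_const
        (fun u => P (S (S n)) u - bern (S (S n)) u - INR (S (S n)) * c * u)).
      intros t; evar_last.
      - apply (is_derive_minus (K := R_AbsRing) (V := R_NormedModule)).
        + apply (is_derive_minus (K := R_AbsRing) (V := R_NormedModule)); [apply dP | apply is_derive_bern].
        + auto_derive; [trivial | reflexivity].
      - unfold minus, plus, opp; simpl; rewrite <- (Hc t); simpl; ring. }
    specialize (Hd 1); rewrite P1, bern_1 in Hd by lia.
    assert (c = 0).
    { assert (0 < INR (S (S n))) by (apply lt_0_INR; lia). nra. }
    intros u; specialize (Hc u); lra. }
  induction n; [intros u; now rewrite P0, bern_deg0 | now apply Hstep].
Qed.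

Lemma bern_reflect n u : bern n (1 - u) = (-1) ^ n * bern n u.
Proof.
  enough (E : (-1) ^ n * bern n (1 - u) = bern n u);
    [|apply (bern_unique (fun n u => (-1) ^ n * bern n (1 - u)))].
  - rewrite <- E, <- Rmult_assoc, <- Rpow_mult_distr.
    replace (-1 * -1) with 1 by ring; rewrite pow1; ring.
  - intros t; rewrite bern_deg0; simpl; ring.
  - intros m t; evar_last.
    + apply (is_derive_scal (fun t => bern (S m) (1 - t)) t ((-1) ^ S m)).
      apply (is_derive_comp (bern (S m)) (fun t => 1 - t)); [apply is_derive_bern|].
      auto_derive; [trivial | reflexivity].
    + unfold scal; simpl; unfold mult; simpl; ring.
  - intros m Hm; replace (1 - 1) with 0 by ring; replace (1 - 0) with 1 by ring.
    now rewrite (bern_1 m Hm).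
Qed.

Lemma bern_duplication n u :
  bern n u = 2 ^ n / 2 * (bern n (u / 2) + bern n (u / 2 + 1 / 2)).
Proof.
  symmetry.
  apply (bern_unique (fun n u => 2 ^ n / 2 * (bern n (u / 2) + bern n (u / 2 + 1 / 2)))).
  - intros t; rewrite !bern_deg0; simpl; lra.
  - intros m t; evar_last.
    + apply (is_derive_scal (fun t => bern (S m) (t / 2) + bern (S m) (t / 2 + 1 / 2)) t
               (2 ^ S m / 2)).
      apply (is_derive_plus (K := R_AbsRing) (V := R_NormedModule)
               (fun t => bern (S m) (t / 2)) (fun t => bern (S m) (t / 2 + 1 / 2))).
      * apply (is_derive_comp (bern (S m)) (fun t => t / 2)); [apply is_derive_bern|].
        auto_derive; [trivial | reflexivity].
      * apply (is_derive_comp (bern (S m)) (fun t => t / 2 + 1 / 2)); [apply is_derive_bern|].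
        auto_derive; [trivial | reflexivity].
    + unfold scal, plus; simpl; unfold mult; simpl; field.
  - intros m Hm.
    replace (0 / 2 + 1 / 2) with (1 / 2) by field.
    replace (1 / 2 + 1 / 2) with 1 by field.
    replace (0 / 2) with 0 by field.
    rewrite (bern_1 m Hm); ring.
Qed.

Lemma bern_half_odd i : bern (2 * i + 1) (1 / 2) = 0.
Proof.
  assert (H := bern_reflect (2 * i + 1) (1 / 2)).
  replace (1 - 1 / 2) with (1 / 2) in H by field.
  rewrite pow_add, pow_1_even in H; lra.
Qed.

Lemma bern_0_odd i : (1 <= i)%nat -> bern (2 * i + 1) 0 = 0.
Proof.
  intros Hi; assert (H := bern_reflect (2 * i + 1) 0).
  replace (1 - 0) with 1 in H by field.
  rewrite bern_1 in H by lia.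
  rewrite pow_add, pow_1_even in H; lra.
Qed.

(** The duplication formula at 0. *)
Lemma bern_half n : bern n (1 / 2) = - (1 - 2 / 2 ^ n) * bern n 0.
Proof.
  assert (H := bern_duplication n 0).
  replace (0 / 2 + 1 / 2) with (1 / 2) in H by field.
  replace (0 / 2) with 0 in H by field.
  assert (0 < 2 ^ n) by (apply pow_lt; lra).
  replace (bern n (1 / 2)) with (2 / 2 ^ n * bern n 0 - bern n 0).
  - field; lra.
  - rewrite H at 1; field; lra.
Qed.

Lemma MVT_open (f df : R -> R) a b :
  a < b -> (forall u, is_derive f u (df u)) ->
  exists c, a < c < b /\ f b - f a = df c * (b - a).
Proof.
  intros Hab H.
  destruct (MVT_cor2 f df a b Hab) as [c [E Hc]].
  - intros c _; apply is_derive_Reals, H.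
  - now exists c.
Qed.

(** Both claims are proved together, by induction on k. If the odd polynomial of degree
    2k - 1 has a constant sign, the next one is monotone; the one after it then has a
    monotone derivative, hence is convex or concave, and vanishes at both ends of the
    interval, so that it has a constant sign in between. *)
Lemma bern_sign k : (1 <= k)%nat ->
  (forall u, 0 < u < 1 / 2 -> 0 < (-1) ^ k * bern (2 * k - 1) u) /\
  (forall u v, 0 <= u -> u < v -> v <= 1 / 2 ->
     (-1) ^ k * bern (2 * k) u < (-1) ^ k * bern (2 * k) v).
Proof.
  intros Hk.
  assert (Hinc : forall k, (1 <= k)%nat ->
    (forall u, 0 < u < 1 / 2 -> 0 < (-1) ^ k * bern (2 * k - 1) u) ->
    (forall u v, 0 <= u -> u < v -> v <= 1 / 2 ->
      (-1) ^ k * bern (2 * k) u < (-1) ^ k * bern (2 * k) v)).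
  { clear; intros k Hk H u v Hu Huv Hv.
    replace (2 * k)%nat with (S (2 * k - 1)) by lia.
    destruct (MVT_open (bern (S (2 * k - 1))) _ u v Huv
                (is_derive_bern (2 * k - 1))) as [c [Hc E]].
    specialize (H c ltac:(lra)).
    assert (0 < INR (S (2 * k - 1))) by (apply lt_0_INR; lia).
    apply Rminus_lt_0.
    replace (_ - _) with ((-1) ^ k * (bern (S (2 * k - 1)) v - bern (S (2 * k - 1)) u)) by ring.
    rewrite E.
    replace (_ * _) with
      (INR (S (2 * k - 1)) * (((-1) ^ k * bern (2 * k - 1) c) * (v - u))) by ring.
    apply Rmult_lt_0_compat; [assumption|]. apply Rmult_lt_0_compat; lra. }
  assert (H : forall u, 0 < u < 1 / 2 -> 0 < (-1) ^ k * bern (2 * k - 1) u);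
    [|now split; [|apply Hinc]].
  induction k as [|k IH]; [lia|]. clear Hk.
  destruct (Nat.eq_dec k 0) as [->|Hk0].
  { intros u Hu; simpl; change (2 * 1 - 1)%nat with 1%nat; rewrite bern_deg1; lra. }
  assert (Hk : (1 <= k)%nat) by lia.
  specialize (Hinc k Hk (IH Hk)).
  replace (2 * S k - 1)%nat with (S (2 * k)) by lia.
  intros u Hu.
  assert (H0 : bern (S (2 * k)) 0 = 0).
  { replace (S (2 * k)) with (2 * k + 1)%nat by lia; now apply bern_0_odd. }
  assert (H1 : bern (S (2 * k)) (1 / 2) = 0).
  { replace (S (2 * k)) with (2 * k + 1)%nat by lia; apply bern_half_odd. }
  (* The slopes of the chords on both sides of u are values of the derivative at c < d. *)
  destruct (MVT_open _ _ 0 u (proj1 Hu) (is_derive_bern (2 * k))) as [c [Hc Ec]].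
  destruct (MVT_open _ _ u (1 / 2) (proj2 Hu) (is_derive_bern (2 * k))) as [d [Hd Ed]].
  specialize (Hinc c d ltac:(lra) ltac:(lra) ltac:(lra)).
  rewrite H0 in Ec; rewrite H1 in Ed.
  set (e := (-1) ^ k) in *; set (N := INR (S (2 * k))) in *.
  assert (HN : 0 < N) by (apply lt_0_INR; lia).
  assert (A : e * bern (S (2 * k)) u = N * (e * bern (2 * k) c) * u) by (rewrite Rminus_0_r in Ec; rewrite Ec; ring).
  assert (B : - (e * bern (S (2 * k)) u) = N * (e * bern (2 * k) d) * (1 / 2 - u)).
  { replace (- (e * bern (S (2 * k)) u)) with (e * (0 - bern (S (2 * k)) u)) by ring; rewrite Ed; ring. }
  replace ((-1) ^ S k) with (- e) by (unfold e; simpl; ring).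
  set (g := e * bern (S (2 * k)) u) in *.
  set (C' := e * bern (2 * k) c) in *; set (D' := e * bern (2 * k) d) in *.
  replace (- e * bern (S (2 * k)) u) with (- g) by (unfold g; ring).
  assert ((1 / 2 - u) * g < u * (- g)).
  { rewrite B, A.
    replace ((1 / 2 - u) * (N * C' * u)) with (N * (u * (1 / 2 - u)) * C') by ring.
    replace (u * (N * D' * (1 / 2 - u))) with (N * (u * (1 / 2 - u)) * D') by ring.
    apply Rmult_lt_compat_l; [|assumption].
    repeat apply Rmult_lt_0_compat; lra. }
  lra.
Qed.

Lemma two_pow_ge k : (1 <= k)%nat -> 0 < 2 / 2 ^ (2 * k) <= 1 / 2.
Proof.
  intros Hk.
  assert (4 <= 2 ^ (2 * k)).
  { replace 4 with (2 ^ 2) by ring; apply Rle_pow; [lra | lia]. }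
  split; [apply Rdiv_lt_0_compat; lra|].
  apply Rle_div_l; lra.
Qed.

Lemma bern_even_0_neq k : (1 <= k)%nat -> bern (2 * k) 0 <> 0.
Proof.
  intros Hk E.
  destruct (bern_sign k Hk) as [_ H].
  specialize (H 0 (1 / 2) ltac:(lra) ltac:(lra) ltac:(lra)).
  rewrite bern_half, E in H; lra.
Qed.

(** On [0, 1/2] the polynomial is monotone, so its modulus is largest at an end; the
    value at 1/2 is the smaller one, being -(1 - 2^(1-2k)) times the value at 0.
    Reflection covers [1/2, 1]. *)
Lemma bern_even_bound k u : (1 <= k)%nat -> 0 <= u <= 1 ->
  Rabs (bern (2 * k) u) <= Rabs (bern (2 * k) 0).
Proof.
  intros Hk.
  assert (H : forall u, 0 <= u <= 1 / 2 -> Rabs (bern (2 * k) u) <= Rabs (bern (2 * k) 0)).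
  { clear u; intros u Hu.
    destruct (bern_sign k Hk) as [_ Hm].
    set (e := (-1) ^ k) in *.
    assert (He : forall t, Rabs (bern (2 * k) t) = Rabs (e * bern (2 * k) t)).
    { intros t; rewrite Rabs_mult; unfold e; rewrite <- RPow_abs.
      replace (Rabs (-1)) with 1 by (rewrite Rabs_left; lra); rewrite pow1; ring. }
    assert (L : e * bern (2 * k) 0 <= e * bern (2 * k) u).
    { destruct (Req_dec u 0) as [->|]; [lra | left; apply Hm; lra]. }
    assert (U : e * bern (2 * k) u <= e * bern (2 * k) (1 / 2)).
    { destruct (Req_dec u (1 / 2)) as [->|]; [lra | left; apply Hm; lra]. }
    assert (P := two_pow_ge k Hk).
    rewrite bern_half in U; rewrite !He.
    set (b := e * bern (2 * k) 0) in *.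
    replace (e * (- (1 - 2 / 2 ^ (2 * k)) * bern (2 * k) 0))
      with (- (1 - 2 / 2 ^ (2 * k)) * b) in U by (unfold b; ring).
    assert (b <= 0) by nra.
    rewrite (Rabs_left1 b) by assumption.
    apply Rabs_le; nra. }
  intros Hu; destruct (Rle_dec u (1 / 2)); [apply H; lra|].
  replace u with (1 - (1 - u)) by ring.
  rewrite bern_reflect, pow_1_even, Rmult_1_l; apply H; lra.
Qed.

Lemma eta_pow k : (1 <= k)%nat -> eta k = / (1 - 2 / 2 ^ (2 * k)).
Proof.
  intros Hk; unfold eta.
  replace (powerRZ 2 (1 - 2 * Z.of_nat k)) with (2 / 2 ^ (2 * k)); [unfold Rdiv; ring|].
  unfold Z.sub; rewrite powerRZ_add by lra.
  rewrite powerRZ_neg'; replace (2 * Z.of_nat k)%Z with (Z.of_nat (2 * k)) by lia.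
  rewrite <- pow_powerRZ; change (powerRZ 2 1) with (2 ^ 1); rewrite pow_1; reflexivity.
Qed.

(** * Wallis's product *)

Fixpoint wallis (n : nat) : R :=
  match n with
  | O => 1
  | S m => wallis m * ((2 * INR m + 1) / (2 * INR m + 2))
  end.

(** Wallis's integrals. *)
Definition sin_int (n : nat) : R := RInt (fun t => sin t ^ n) 0 (PI / 2).

Lemma continuous_sin_pow n t : continuous (fun t => sin t ^ n) t.
Proof.
  apply (ex_derive_continuous (K := R_AbsRing) (V := R_NormedModule)).
  auto_derive; trivial.
Qed.

Lemma ex_RInt_sin_pow n : ex_RInt (fun t => sin t ^ n) 0 (PI / 2).
Proof. apply (ex_RInt_continuous (V := R_CompleteNormedModule)); intros; apply continuous_sin_pow. Qed.

Lemma sin_int_0 : sin_int 0 = PI / 2.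
Proof.
  unfold sin_int; simpl; rewrite RInt_const; unfold scal; simpl; unfold mult; simpl; ring.
Qed.

Lemma sin_int_1 : sin_int 1 = 1.
Proof.
  unfold sin_int; apply is_RInt_unique.
  replace 1 with (minus (- cos (PI / 2)) (- cos 0)) by
    (rewrite cos_PI2, cos_0; unfold minus, plus, opp; simpl; ring).
  apply (is_RInt_derive (V := R_CompleteNormedModule) (fun t => - cos t)).
  - intros t _; auto_derive; [trivial | ring].
  - intros t _; apply continuous_sin_pow.
Qed.

(** Integration by parts, in the form of the vanishing integral of the derivative of
    sin^(n+1) cos. *)
Lemma sin_int_SS n : (INR n + 2) * sin_int (S (S n)) = (INR n + 1) * sin_int n.
Proof.
  assert (H : is_RInt (fun t => minus (scal (INR n + 1) (sin t ^ n))
                                      (scal (INR n + 2) (sin t ^ S (S n)))) 0 (PI / 2) 0).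
  { replace 0 with (minus (sin (PI / 2) ^ S n * cos (PI / 2)) (sin 0 ^ S n * cos 0)) at 2
      by (rewrite cos_PI2, sin_0; unfold minus, plus, opp; simpl; ring).
    apply (is_RInt_derive (V := R_CompleteNormedModule) (fun t => sin t ^ S n * cos t)).
    - intros t _; auto_derive; [trivial|].
      unfold minus, plus, opp, scal; simpl; unfold mult; simpl.
      assert (E := sin2_cos2 t); unfold Rsqr in E.
      replace (cos t * 1) with (cos t) by ring.
      match goal with |- _ = ?r => set (r0 := r) end.
      transitivity ((INR n + 1) * sin t ^ n * (cos t * cos t) - sin t ^ n * (sin t * sin t)).
      + destruct n; simpl; ring.
      + replace (cos t * cos t) with (1 - sin t * sin t) by lra; unfold r0; ring.
    - intros t _; apply (ex_derive_continuous (K := R_AbsRing) (V := R_NormedModule)).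
      unfold minus, plus, opp, scal; simpl; unfold mult; simpl; auto_derive; trivial. }
  assert (H' := is_RInt_minus _ _ _ _ _ _
    (is_RInt_scal _ _ _ (INR n + 1) _ (RInt_correct (V := R_CompleteNormedModule) _ _ _ (ex_RInt_sin_pow n)))
    (is_RInt_scal _ _ _ (INR n + 2) _ (RInt_correct (V := R_CompleteNormedModule) _ _ _ (ex_RInt_sin_pow (S (S n)))))).
  assert (E := is_RInt_unique _ _ _ _ H); apply is_RInt_unique in H'; unfold minus, plus, opp, scal in E, H'; simpl in E, H';
  unfold mult in E, H'; simpl in E, H'; rewrite E in H'.
  change (RInt (fun t => sin t * (sin t * sin t ^ n)) 0 (PI / 2)) with (sin_int (S (S n))) in H'.
  change (RInt (fun t => sin t ^ n) 0 (PI / 2)) with (sin_int n) in H'.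
  lra.
Qed.

Lemma sin_open_bounds t : 0 < t < PI / 2 -> 0 < sin t < 1.
Proof.
  intros Ht; split; [apply sin_gt_0; lra|].
  rewrite <- sin_PI2; apply sin_increasing_1; lra.
Qed.

Lemma sin_int_pos n : 0 < sin_int n.
Proof.
  assert (P := PI_RGT_0).
  apply RInt_gt_0; [lra | | intros; apply continuous_sin_pow].
  intros t Ht; apply pow_lt, sin_open_bounds, Ht.
Qed.

Lemma sin_int_decr n : sin_int (S n) < sin_int n.
Proof.
  assert (P := PI_RGT_0).
  apply RInt_lt; [lra | intros; apply continuous_sin_pow | intros; apply continuous_sin_pow |].
  intros t Ht; assert (H := sin_open_bounds t Ht).
  assert (0 < sin t ^ n) by (apply pow_lt, H); simpl; nra.
Qed.

Lemma sin_int_prod n : (INR n + 1) * (sin_int n * sin_int (S n)) = PI / 2.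
Proof.
  induction n as [|n IH].
  - rewrite sin_int_0, sin_int_1; simpl; ring.
  - rewrite <- IH, S_INR.
    replace ((INR n + 1 + 1) * (sin_int (S n) * sin_int (S (S n)))) with
      (sin_int (S n) * ((INR n + 2) * sin_int (S (S n)))) by ring.
    rewrite sin_int_SS; ring.
Qed.

Lemma sin_int_even n : sin_int (2 * n) = PI / 2 * wallis n.
Proof.
  induction n as [|n IH].
  - change (2 * 0)%nat with 0%nat; rewrite sin_int_0; simpl; ring.
  - replace (2 * S n)%nat with (S (S (2 * n))) by lia.
    assert (H := sin_int_SS (2 * n)); rewrite IH, mult_INR in H; change (INR 2) with 2 in H.
    assert (0 <= INR n) by apply pos_INR.
    simpl wallis.
    apply (Rmult_eq_reg_l (2 * INR n + 2)); [|lra].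
    rewrite H; field; lra.
Qed.

Lemma wallis_pos n : 0 < wallis n.
Proof.
  assert (H := sin_int_pos (2 * n)); rewrite sin_int_even in H.
  assert (P := PI_RGT_0); nra.
Qed.

(** The Wallis integrals decrease, and the product of two consecutive ones is known: the
    square of the one of index 2n lies between two such products. *)
Lemma wallis_bounds n : (1 <= n)%nat ->
  2 / (2 * INR n + 1) < PI * wallis n ^ 2 /\ INR n * (PI * wallis n ^ 2) < 1.
Proof.
  intros Hn.
  assert (P := PI_RGT_0).
  assert (1 <= INR n) by (apply (le_INR 1), Hn).
  assert (W := wallis_pos n).
  assert (A := sin_int_decr (2 * n)).
  assert (B := sin_int_prod (2 * n)).
  assert (A' := sin_int_decr (2 * n - 1)).
  assert (B' := sin_int_prod (2 * n - 1)).
  replace (S (2 * n - 1)) with (2 * n)%nat in * by lia.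
  rewrite minus_INR in B' by lia.
  rewrite sin_int_even, mult_INR in *; change (INR 2) with 2 in *; change (INR 1) with 1 in *.
  set (w := wallis n) in *.
  set (s := sin_int (S (2 * n))) in *; set (s' := sin_int (2 * n - 1)) in *.
  split.
  - apply Rlt_div_l; [lra|].
    apply (Rmult_lt_reg_l (PI / 4)); [lra|].
    replace (PI / 4 * 2) with ((2 * INR n + 1) * (PI / 2 * w * s)) by lra.
    replace (PI / 4 * (PI * w ^ 2 * (2 * INR n + 1))) with
      ((2 * INR n + 1) * (PI / 2 * w * (PI / 2 * w))) by field.
    apply Rmult_lt_compat_l; [lra|]; apply Rmult_lt_compat_l; [nra | assumption].
  - apply (Rmult_lt_reg_l (PI / 2)); [lra|].
    replace (PI / 2 * 1) with ((2 * INR n - 1 + 1) * (s' * (PI / 2 * w))) by lra.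
    replace (PI / 2 * (INR n * (PI * w ^ 2))) with
      ((2 * INR n - 1 + 1) * (PI / 2 * w * (PI / 2 * w))) by field.
    apply Rmult_lt_compat_l; [lra|]; apply Rmult_lt_compat_r; [nra | assumption].
Qed.

(** This is where the strictness of the final inequality and the constant in it come
    from: the left side is sqrt PI * Gamma (k + 1/2) / Gamma k. *)
Lemma wallis_sqrt_bound k : (1 <= k)%nat -> INR k * PI * wallis k < sqrt (PI * INR k).
Proof.
  intros Hk.
  assert (P := PI_RGT_0); assert (W := wallis_pos k).
  assert (1 <= INR k) by (apply (le_INR 1), Hk).
  destruct (wallis_bounds k Hk) as [_ H1].
  rewrite <- (sqrt_pow2 (INR k * PI * wallis k)).
  - apply sqrt_lt_1; [apply pow2_ge_0 | nra |].
    replace ((INR k * PI * wallis k) ^ 2) with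
      (PI * INR k * (INR k * (PI * wallis k ^ 2))) by ring.
    rewrite <- (Rmult_1_r (PI * INR k)) at 2.
    apply Rmult_lt_compat_l; [nra | assumption].
  - apply Rmult_le_pos; nra.
Qed.

Lemma wallis_fact n : wallis n * (2 ^ (2 * n) * INR (fact n) ^ 2) = INR (fact (2 * n)).
Proof.
  induction n as [|n IH]; [simpl; ring|].
  replace (2 * S n)%nat with (S (S (2 * n))) by lia.
  rewrite !fact_simpl, !mult_INR, <- IH, !S_INR, mult_INR; change (INR 2) with 2.
  assert (0 <= INR n) by apply pos_INR.
  simpl; field; lra.
Qed.

(** * Stirling's constant *)

(** Stirling's formula says that this sequence tends to ln (2 PI) / 2. Its convergence
    will come from Euler-Maclaurin summation; the value of the limit comes from
    Wallis's product. *)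
Definition stirling_defect (n : nat) : R :=
  ln (INR (fact n)) - (INR n + 1 / 2) * ln (INR n) + INR n.

Lemma stirling_double n : (1 <= n)%nat ->
  stirling_defect (2 * n) - 2 * stirling_defect n =
  1 / 2 * ln (INR n * (PI * wallis n ^ 2)) - 1 / 2 * ln (2 * PI).
Proof.
  intros Hn.
  assert (P := PI_RGT_0); assert (W := wallis_pos n).
  assert (1 <= INR n) by (apply (le_INR 1), Hn).
  assert (F := INR_fact_lt_0 n).
  unfold stirling_defect.
  rewrite <- wallis_fact, mult_INR; change (INR 2) with 2.
  assert (0 < 2 ^ (2 * n)) by (apply pow_lt; lra).
  assert (0 < wallis n ^ 2) by now apply pow_lt.
  assert (0 < INR (fact n) ^ 2) by now apply pow_lt.
  rewrite (ln_mult (wallis n)), (ln_mult (2 ^ _)), (ln_mult 2 (INR n)), (ln_mult (INR n)),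
    (ln_mult PI), (ln_mult 2 PI) by
    repeat (first [assumption | lra | apply Rmult_lt_0_compat]).
  rewrite !ln_pow, mult_INR by (try assumption; lra).
  change (INR 2) with 2; field.
Qed.

(** In the combination d(2n) - 2 d(n) of the defects d, whose limit is c - 2c = - c, only
    Wallis's product is left. *)
Lemma stirling_limit (c : R) :
  is_lim_seq stirling_defect c -> c = 1 / 2 * ln (2 * PI).
Proof.
  intros Hc.
  assert (P := PI_RGT_0).
  assert (L1 : is_lim_seq (fun n => INR n * (PI * wallis n ^ 2)) 1).
  { apply (is_lim_seq_le_le_loc (fun n => 1 - / (2 * INR n + 1)) _ (fun _ => 1)).
    - exists 1%nat; intros n Hn.
      assert (1 <= INR n) by (apply (le_INR 1), Hn).
      destruct (wallis_bounds n Hn) as [A B]; split; [|lra].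
      replace (1 - / (2 * INR n + 1)) with (INR n * (2 / (2 * INR n + 1))) by (field; lra).
      apply Rmult_le_compat_l; lra.
    - evar_last.
      + apply is_lim_seq_minus'; [apply is_lim_seq_const|].
        apply (is_lim_seq_inv _ p_infty); [|easy].
        apply (is_lim_seq_le_p_loc INR); [|apply is_lim_seq_INR].
        exists 0%nat; intros n _; assert (0 <= INR n) by apply pos_INR; lra.
      + simpl; f_equal; ring.
    - apply is_lim_seq_const. }
  assert (L2 : is_lim_seq (fun n => stirling_defect (2 * n) - 2 * stirling_defect n)
                 (1 / 2 * ln 1 - 1 / 2 * ln (2 * PI))).
  { apply is_lim_seq_ext_loc with
      (fun n => 1 / 2 * ln (INR n * (PI * wallis n ^ 2)) - 1 / 2 * ln (2 * PI)).
    - exists 1%nat; intros n Hn; symmetry; now apply stirling_double.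
    - apply is_lim_seq_minus'; [|apply is_lim_seq_const].
      apply (is_lim_seq_mult' (fun _ => 1 / 2)); [apply is_lim_seq_const|].
      apply (is_lim_seq_continuous ln); [|exact L1].
      apply derivable_continuous_pt; exists (/ 1); apply derivable_pt_lim_ln; lra. }
  assert (L3 : is_lim_seq (fun n => stirling_defect (2 * n) - 2 * stirling_defect n) (c - 2 * c)).
  { apply is_lim_seq_minus'.
    - apply (is_lim_seq_subseq stirling_defect c (fun n => (2 * n)%nat)); [|exact Hc].
      apply eventually_subseq; intros n; lia.
    - apply (is_lim_seq_mult' (fun _ => 2)); [apply is_lim_seq_const | exact Hc]. }
  apply is_lim_seq_unique in L2; apply is_lim_seq_unique in L3.
  rewrite L2 in L3; injection L3 as E; rewrite ln_1 in E; lra.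
Qed.

(** * The integrals of (1 + t^2)^(-k-1) *)

(** The primitive of 1 / (1 + t^2)^(k+1) that vanishes at 0, by its reduction formula. *)
Fixpoint arctan_pow (k : nat) (u : R) : R :=
  match k with
  | O => atan u
  | S m => u / ((2 * INR m + 2) * (1 + u ^ 2) ^ (S m)) +
           (2 * INR m + 1) / (2 * INR m + 2) * arctan_pow m u
  end.

Lemma arctan_pow_0 k : arctan_pow k 0 = 0.
Proof.
  induction k as [|k IH]; simpl arctan_pow; [apply atan_0|].
  rewrite IH; unfold Rdiv; ring.
Qed.

Lemma is_derive_arctan_pow k u :
  is_derive (arctan_pow k) u (/ (1 + u ^ 2) ^ S k).
Proof.
  induction k as [|k IH].
  - simpl arctan_pow; auto_derive; [trivial|].
    assert (0 <= u * u) by nra. field; nra.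
  - simpl arctan_pow.
    assert (0 < 1 + u * u) by nra.
    assert (0 < (1 + u * (u * 1)) ^ k) by (apply pow_lt; nra).
    assert (0 <= INR k) by apply pos_INR.
    evar_last.
    + apply (is_derive_plus (K := R_AbsRing) (V := R_NormedModule)
        (fun u => u / ((2 * INR k + 2) * ((1 + u * (u * 1)) * (1 + u * (u * 1)) ^ k)))
        (fun u => (2 * INR k + 1) / (2 * INR k + 2) * arctan_pow k u)).
      * auto_derive; [|reflexivity].
        apply Rgt_not_eq; repeat apply Rmult_lt_0_compat; nra.
      * apply (is_derive_scal (arctan_pow k)), IH.
    + unfold plus, scal; simpl; unfold mult; simpl.
      destruct k as [|k].
      * simpl; field; nra.
      * rewrite S_INR in *; simpl pred.
        assert (0 < (1 + u * (u * 1)) ^ k) by (apply pow_lt; nra).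
        simpl ((1 + u * (u * 1)) ^ S k) in *.
        set (y := (1 + u * (u * 1)) ^ k) in *.
        field; repeat split; nra.
Qed.

Lemma arctan_pow_incr k u v : u <= v -> arctan_pow k u <= arctan_pow k v.
Proof.
  intros H; destruct (Req_dec u v) as [->|]; [lra|].
  destruct (MVT_cor2 (arctan_pow k) (fun u => / (1 + u ^ 2) ^ S k) u v) as [c [E _]];
    [lra | intros; apply is_derive_Reals, is_derive_arctan_pow |].
  assert (0 < / (1 + c ^ 2) ^ S k) by (apply Rinv_0_lt_compat, pow_lt; nra).
  nra.
Qed.

(** The rational part of the reduction formula is at most 1 / u at each step. *)
Lemma arctan_pow_le_aux k u : 0 < u -> arctan_pow k u <= PI / 2 * wallis k + INR k / u.
Proof.
  intros Hu; induction k as [|k IH].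
  - simpl; assert (H := atan_bound u); unfold Rdiv; lra.
  - simpl arctan_pow; simpl wallis; rewrite S_INR.
    assert (0 <= INR k) by apply pos_INR.
    assert (0 < / u) by now apply Rinv_0_lt_compat.
    set (r := (2 * INR k + 1) / (2 * INR k + 2)).
    assert (0 < r <= 1).
    { unfold r; split; [apply Rdiv_lt_0_compat; lra | apply Rle_div_l; lra]. }
    assert (A : u / ((2 * INR k + 2) * ((1 + u * (u * 1)) * (1 + u * (u * 1)) ^ k)) <= / u).
    { assert (1 <= (1 + u * (u * 1)) ^ k) by (apply pow_R1_Rle; nra).
      set (y := (1 + u * (u * 1)) ^ k) in *.
      assert (u * u <= (1 + u * (u * 1)) * y) by nra.
      assert (D : u * u <= (2 * INR k + 2) * ((1 + u * (u * 1)) * y)) by nra.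
      apply Rle_div_l; [nra|].
      apply (Rmult_le_reg_l u); [assumption|].
      rewrite <- Rmult_assoc, Rinv_r, Rmult_1_l by lra; exact D. }
    assert (B : r * arctan_pow k u <= r * (PI / 2 * wallis k + INR k / u))
      by (apply Rmult_le_compat_l; lra).
    assert (0 <= INR k / u) by (apply Rmult_le_pos; lra).
    unfold Rdiv in *; nra.
Qed.

(** The bound is the integral over the half-line. It holds up to an error k / v at a
    large v, and the primitive increases. *)
Lemma arctan_pow_le k u : arctan_pow k u <= PI / 2 * wallis k.
Proof.
  apply Rnot_lt_le; intros H.
  set (e := arctan_pow k u - PI / 2 * wallis k).
  assert (He : 0 < e) by (unfold e; lra).
  assert (Hk := pos_INR k).
  (* Beyond u, and far enough for k / v < e. *)
  set (v := Rabs u + 1 + INR k / e + 1).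
  assert (0 <= INR k / e) by (apply Rmult_le_pos; [lra | left; now apply Rinv_0_lt_compat]).
  assert (Hu := Rabs_pos u); assert (Hu' := Rle_abs u).
  assert (A := arctan_pow_incr k u v ltac:(unfold v; lra)).
  assert (B := arctan_pow_le_aux k v ltac:(unfold v; lra)).
  assert (C : INR k / v < e).
  { apply Rlt_div_l; [unfold v; lra|].
    assert (e * (INR k / e) = INR k) by (field; lra).
    unfold v; nra. }
  unfold e in *; lra.
Qed.

(** * Complex numbers *)

Lemma Ceq (a b : C) : Re a = Re b -> Im a = Im b -> a = b.
Proof. destruct a, b; simpl; now intros -> ->. Qed.

Lemma Re_plus a b : Re (a + b)%C = Re a + Re b. Proof. reflexivity. Qed.
Lemma Im_plus a b : Im (a + b)%C = Im a + Im b. Proof. reflexivity. Qed.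
Lemma Re_minus a b : Re (a - b)%C = Re a - Re b. Proof. reflexivity. Qed.
Lemma Im_minus a b : Im (a - b)%C = Im a - Im b. Proof. reflexivity. Qed.
Lemma Re_mult a b : Re (a * b)%C = Re a * Re b - Im a * Im b. Proof. reflexivity. Qed.
Lemma Im_mult a b : Im (a * b)%C = Re a * Im b + Im a * Re b. Proof. reflexivity. Qed.
Lemma Re_RtoC x : Re (RtoC x) = x. Proof. reflexivity. Qed.
Lemma Im_RtoC x : Im (RtoC x) = 0. Proof. reflexivity. Qed.

Lemma Im_abs_le z : Rabs (Im z) <= Cmod z.
Proof. eapply Rle_trans; [apply Rmax_r | apply (Rmax_Cmod z)]. Qed.

Lemma Cmod_le_abs z : Cmod z <= Rabs (Re z) + Rabs (Im z).
Proof.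
  assert (H := Cmod2_alt z); assert (H0 := Cmod_ge_0 z).
  assert (H1 := Rabs_pos (Re z)); assert (H2 := Rabs_pos (Im z)).
  assert (H3 := pow2_abs (Re z)); assert (H4 := pow2_abs (Im z)).
  apply Rnot_lt_le; intros Hl; nra.
Qed.

Lemma Cmod_ge_Re z : Re z <= Cmod z.
Proof. eapply Rle_trans; [apply Rle_abs | apply re_le_Cmod]. Qed.

Lemma Cmod_dist_sym a b : Cmod (a - b) = Cmod (b - a).
Proof. rewrite <- Cmod_opp; f_equal; ring. Qed.

(** * The complex exponential and logarithm *)

Lemma Cexp_plus a b : Cexp (a + b) = (Cexp a * Cexp b)%C.
Proof.
  unfold Cexp; apply Ceq; simpl; rewrite exp_plus, ?cos_plus, ?sin_plus; unfold Re, Im; ring.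
Qed.

Lemma Cexp_RtoC x : Cexp (RtoC x) = RtoC (exp x).
Proof. unfold Cexp, RtoC; simpl; rewrite cos_0, sin_0; f_equal; ring. Qed.

Lemma Cexp_neq_0 a : Cexp a <> 0.
Proof.
  intros E.
  assert (H : (Cexp a * Cexp (- a))%C = 1).
  { rewrite <- Cexp_plus; replace (a + - a)%C with (RtoC 0) by ring.
    rewrite Cexp_RtoC, exp_0; reflexivity. }
  rewrite E in H; apply (f_equal Re) in H; simpl in H; lra.
Qed.

Lemma Cexp_opp a : Cexp (- a) = (/ Cexp a)%C.
Proof.
  assert (H : (Cexp a * Cexp (- a))%C = 1).
  { rewrite <- Cexp_plus; replace (a + - a)%C with (RtoC 0) by ring.
    rewrite Cexp_RtoC, exp_0; reflexivity. }
  assert (N := Cexp_neq_0 a).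
  transitivity (/ Cexp a * (Cexp a * Cexp (- a)))%C; [field; exact N|].
  rewrite H; ring.
Qed.

Lemma Cexp_eq a b : Cexp a = Cexp b -> Re a = Re b /\ cos (Im a - Im b) = 1.
Proof.
  intros E.
  assert (H : Cexp (a - b) = 1).
  { unfold Cminus; rewrite Cexp_plus, Cexp_opp, E; field; apply Cexp_neq_0. }
  assert (H1 : exp (Re a - Re b) * cos (Im a - Im b) = 1) by exact (f_equal Re H).
  assert (H2 : exp (Re a - Re b) * sin (Im a - Im b) = 0) by exact (f_equal Im H).
  assert (P := exp_pos (Re a - Re b)).
  set (e := exp (Re a - Re b)) in *; set (t := Im a - Im b) in *.
  assert (S0 := sin2_cos2 t); unfold Rsqr in S0.
  destruct (Rmult_integral _ _ H2) as [|Hs]; [lra|]; rewrite Hs in S0.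
  assert (Hc : cos t = 1) by nra.
  rewrite Hc in H1; split; [|exact Hc].
  assert (Re a - Re b = 0); [|lra].
  apply exp_inv; rewrite exp_0; unfold e in H1; lra.
Qed.

Lemma slit_plane_pos z : slit_plane z <-> 0 < Cmod z + Re z.
Proof.
  assert (H := Cmod2_alt z); assert (H0 := Cmod_ge_0 z).
  unfold slit_plane; split; intros Hs.
  - apply Rnot_le_lt; intros Hle; apply Hs.
    assert (Cmod z * Cmod z <= Re z * Re z) by nra.
    assert (Im z * Im z <= 0) by lra.
    split; [nra | lra].
  - intros [A B]; rewrite A in H.
    assert (Cmod z = - Re z) by (apply Rsqr_inj; unfold Rsqr; lra). lra.
Qed.

Lemma slit_plane_half z : 0 <= Re z -> z <> 0 -> slit_plane z.
Proof.
  intros Hr Hz; apply slit_plane_pos; apply Cmod_gt_0 in Hz; lra.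
Qed.

Lemma slit_plane_neq_0 z : slit_plane z -> z <> 0.
Proof. intros H E; apply H; rewrite E; simpl; split; lra. Qed.

Lemma Re_pos_neq_0 z : 0 < Re z -> z <> 0.
Proof. intros H E; rewrite E in H; simpl in H; lra. Qed.

(** The half-angle formula. Unlike the definition by cases through acos, this expression is
    smooth on the whole slit plane, the imaginary and positive real axes included. *)
Lemma Carg_atan z : slit_plane z -> Carg z = 2 * atan (Im z / (Cmod z + Re z)).
Proof.
  intros Hs.
  assert (Hr := proj1 (Cmod_gt_0 z) (slit_plane_neq_0 z Hs)).
  apply slit_plane_pos in Hs.
  assert (H := Cmod2_alt z).
  set (r := Cmod z) in *; set (x := Re z) in *; set (y := Im z) in *.
  set (t := y / (r + x)).
  assert (B := atan_bound t).
  assert (Hc : cos (2 * atan t) = x / r).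
  { rewrite cos_2a_cos, cos_atan.
    replace (1 / sqrt (1 + t²)) with (/ sqrt (1 + t²)) by (field; apply Rgt_not_eq, sqrt_lt_R0; unfold Rsqr; nra).
    assert (0 < 1 + t * t) by nra.
    replace (2 * / sqrt (1 + t²) * / sqrt (1 + t²)) with (2 / (1 + t * t)).
    - assert (E : 1 + t * t = 2 * r / (r + x)).
      { unfold t; apply (Rmult_eq_reg_r ((r + x) * (r + x))); [|nra].
        field_simplify; [nra | lra | lra]. }
      rewrite E; field; lra.
    - assert (E := sqrt_def (1 + t²) ltac:(unfold Rsqr; nra)).
      assert (0 < sqrt (1 + t²)) by (apply sqrt_lt_R0; unfold Rsqr; nra).
      replace (1 + t * t) with (sqrt (1 + t²) * sqrt (1 + t²)) by (rewrite E; reflexivity).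
      field; lra. }
  unfold Carg; fold x y r.
  destruct (Rle_dec 0 y) as [Hy|Hy].
  - rewrite <- Hc, acos_cos; [reflexivity|].
    split; [|lra].
    assert (0 <= t) by (apply Rmult_le_pos; [lra | left; apply Rinv_0_lt_compat; lra]).
    destruct (Req_dec t 0) as [->|]; [rewrite atan_0; lra|].
    assert (atan 0 < atan t) by (apply atan_increasing; lra).
    rewrite atan_0 in *; lra.
  - rewrite <- Hc, <- cos_neg, acos_cos; [ring|].
    assert (t < 0).
    { unfold t, Rdiv; assert (0 < / (r + x)) by (apply Rinv_0_lt_compat; lra); nra. }
    assert (atan t < atan 0) by (apply atan_increasing; lra).
    rewrite atan_0 in *; lra.
Qed.

Lemma Clog_RtoC x : 0 < x -> Clog (RtoC x) = RtoC (ln x).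
Proof.
  intros Hx; unfold Clog.
  rewrite Carg_atan.
  - rewrite Cmod_R, Rabs_pos_eq by lra; simpl Im.
    unfold Rdiv; rewrite Rmult_0_l, atan_0; unfold RtoC; f_equal; ring.
  - unfold slit_plane; simpl; lra.
Qed.

Lemma Cexp_Clog (z : C) : z <> 0 -> Cexp (Clog z) = z.
Proof.
  intros Hz; assert (Hr := proj1 (Cmod_gt_0 z) Hz).
  assert (H := Cmod2_alt z).
  unfold Cexp, Clog; simpl fst; simpl snd.
  change (Re (ln (Cmod z), Carg z)) with (ln (Cmod z)).
  change (Im (ln (Cmod z), Carg z)) with (Carg z).
  rewrite exp_ln by assumption.
  set (r := Cmod z) in *.
  assert (Hq : -1 <= Re z / r <= 1).
  { split; [apply Rle_div_r | apply Rle_div_l]; nra. }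
  assert (Hs : sin (acos (Re z / r)) = Rabs (Im z) / r).
  { rewrite sin_acos by exact Hq.
    replace (1 - (Re z / r)²) with ((Rabs (Im z) / r)²).
    - apply sqrt_Rsqr, Rmult_le_pos; [apply Rabs_pos | left; now apply Rinv_0_lt_compat].
    - unfold Rsqr.
      replace (Rabs (Im z) / r * (Rabs (Im z) / r)) with (Rabs (Im z) ^ 2 / (r ^ 2)) by (field; lra).
      rewrite pow2_abs; replace (Im z ^ 2) with (r ^ 2 - Re z ^ 2) by lra.
      field; lra. }
  apply Ceq; simpl; unfold Carg; fold r; destruct (Rle_dec 0 (Im z)) as [Hy|Hy];
    rewrite ?cos_neg, ?sin_neg, ?cos_acos, ?Hs by exact Hq.
  - field; lra.
  - field; lra.
  - rewrite Rabs_pos_eq by lra; field; lra.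
  - rewrite Rabs_left by lra; field; lra.
Qed.

(** * Complex functions of a real variable *)

(** Differentiation is stated on the two components, so that the calculus of real
    functions applies to each. *)
Definition is_Cderive (f : R -> C) (t : R) (l : C) : Prop :=
  is_derive (fun s => Re (f s)) t (Re l) /\ is_derive (fun s => Im (f s)) t (Im l).

Lemma is_Cderive_ext f g t l :
  (forall s, f s = g s) -> is_Cderive f t l -> is_Cderive g t l.
Proof.
  intros E [H1 H2]; split; eapply is_derive_ext; try eassumption;
    intros s; simpl; now rewrite E.
Qed.

Lemma is_Cderive_const a t : is_Cderive (fun _ => a) t 0.
Proof. split; apply (is_derive_const (K := R_AbsRing) (V := R_NormedModule)). Qed.

Lemma is_Cderive_line a b t : is_Cderive (fun s => (a + RtoC s * b)%C) t b.
Proof. split; simpl; auto_derive; trivial; unfold Re, Im; ring. Qed.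

Lemma is_Cderive_RtoC (f : R -> R) t l :
  is_derive f t l -> is_Cderive (fun s => RtoC (f s)) t (RtoC l).
Proof.
  intros H; split; simpl; [exact H|].
  apply (is_derive_const (K := R_AbsRing) (V := R_NormedModule)).
Qed.

Lemma is_Cderive_plus f g t a b :
  is_Cderive f t a -> is_Cderive g t b -> is_Cderive (fun s => (f s + g s)%C) t (a + b)%C.
Proof.
  intros [A1 A2] [B1 B2]; split; simpl;
    now apply (is_derive_plus (K := R_AbsRing) (V := R_NormedModule)).
Qed.

Lemma is_Cderive_minus f g t a b :
  is_Cderive f t a -> is_Cderive g t b -> is_Cderive (fun s => (f s - g s)%C) t (a - b)%C.
Proof.
  intros [A1 A2] [B1 B2]; split; simpl;
    now apply (is_derive_minus (K := R_AbsRing) (V := R_NormedModule)).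
Qed.

Lemma is_derive_Rmult (f g : R -> R) t a b :
  is_derive f t a -> is_derive g t b ->
  is_derive (fun s => f s * g s) t (a * g t + f t * b).
Proof. intros A B; apply (is_derive_mult f g t a b A B Rmult_comm). Qed.

Lemma is_Cderive_mult f g t a b :
  is_Cderive f t a -> is_Cderive g t b ->
  is_Cderive (fun s => (f s * g s)%C) t (a * g t + f t * b)%C.
Proof.
  intros [A1 A2] [B1 B2]; split; simpl.
  - evar_last; [apply (is_derive_minus (K := R_AbsRing) (V := R_NormedModule));
      apply is_derive_Rmult; eassumption|].
    unfold minus, plus, opp, Re, Im; simpl; ring.
  - evar_last; [apply (is_derive_plus (K := R_AbsRing) (V := R_NormedModule));
      apply is_derive_Rmult; eassumption|].
    unfold minus, plus, opp, Re, Im; simpl; ring.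
Qed.

Lemma is_derive_Rdiv (f g : R -> R) t a b :
  is_derive f t a -> is_derive g t b -> g t <> 0 ->
  is_derive (fun s => f s / g s) t ((a * g t - f t * b) / g t ^ 2).
Proof. apply is_derive_div. Qed.

Lemma is_derive_sqnorm (x y : R -> R) t a b :
  is_derive x t a -> is_derive y t b ->
  is_derive (fun s => x s ^ 2 + y s ^ 2) t (2 * (x t * a + y t * b)).
Proof.
  intros A B; auto_derive.
  - repeat split; eexists; eassumption.
  - replace (Derive (fun s => x s) t) with a by (symmetry; now apply is_derive_unique).
    replace (Derive (fun s => y s) t) with b by (symmetry; now apply is_derive_unique).
    ring.
Qed.

Lemma is_Cderive_inv f t a :
  is_Cderive f t a -> f t <> 0 ->
  is_Cderive (fun s => (/ f s)%C) t (- a * (/ f t * / f t))%C.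
Proof.
  intros [A1 A2] H.
  assert (P : 0 < Re (f t) ^ 2 + Im (f t) ^ 2).
  { apply Cmod_gt_0 in H; rewrite <- Cmod2_alt; now apply pow_lt. }
  assert (D := is_derive_sqnorm _ _ _ _ _ A1 A2).
  split.
  - evar_last; [exact (is_derive_Rdiv _ _ _ _ _ A1 D (Rgt_not_eq _ _ P))|].
    unfold Cinv; simpl; unfold Re, Im in *; simpl; field; simpl in P; lra.
  - evar_last.
    + apply (is_derive_Rdiv (fun s => - Im (f s)) _ _ (- Im a) _
        (is_derive_opp (K := R_AbsRing) (V := R_NormedModule) _ _ _ A2) D (Rgt_not_eq _ _ P)).
    + unfold Cinv; simpl; unfold Re, Im in *; simpl; field; simpl in P; lra.
Qed.

Lemma is_Cderive_pow f t a n :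
  is_Cderive f t a ->
  is_Cderive (fun s => (f s ^ S n)%C) t (RtoC (INR (S n)) * a * f t ^ n)%C.
Proof.
  intros H; induction n as [|n IH].
  - apply (is_Cderive_ext f); [intros s; simpl; ring|].
    simpl; replace (RtoC 1 * a * 1)%C with a by ring; exact H.
  - apply (is_Cderive_ext (fun s => (f s * f s ^ S n)%C)); [reflexivity|].
    replace (RtoC (INR (S (S n))) * a * f t ^ S n)%C with
      (a * f t ^ S n + f t * (RtoC (INR (S n)) * a * f t ^ n))%C.
    + now apply is_Cderive_mult.
    + rewrite (S_INR (S n)), RtoC_plus; simpl; ring.
Qed.

Lemma is_derive_half_angle (x y r : R -> R) t a b :
  is_derive x t a -> is_derive y t b ->
  is_derive r t ((x t * a + y t * b) / r t) ->
  0 < r t -> 0 < r t + x t -> r t * r t = x t * x t + y t * y t ->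
  is_derive (fun s => 2 * atan (y s / (r s + x s))) t
    ((x t * b - y t * a) / (r t * r t)).
Proof.
  intros A B D Hr Hs E; auto_derive.
  - repeat split; try (eexists; eassumption); lra.
  - replace (Derive (fun s => x s) t) with a by (symmetry; now apply is_derive_unique).
    replace (Derive (fun s => y s) t) with b by (symmetry; now apply is_derive_unique).
    replace (Derive (fun s => r s) t) with ((x t * a + y t * b) / r t)
      by (symmetry; now apply is_derive_unique).
    assert (Hsum : (r t + x t) * (r t + x t) + y t * y t = 2 * r t * (r t + x t)) by lra.
    transitivity (2 * (b * (r t + x t) - y t * ((x t * a + y t * b) / r t + a)) /
                      ((r t + x t) * (r t + x t) + y t * y t)).
    { field; repeat split; try lra; nra. }
    rewrite Hsum.
    replace (b * (r t + x t) - y t * ((x t * a + y t * b) / r t + a)) with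
      ((b * (r t * r t - y t * y t) + b * x t * r t - y t * x t * a - y t * a * r t) / r t)
      by (field; lra).
    replace (r t * r t - y t * y t) with (x t * x t) by lra.
    field; lra.
Qed.

Lemma is_Cderive_log f t a :
  is_Cderive f t a -> slit_plane (f t) ->
  is_Cderive (fun s => Clog (f s)) t (a / f t)%C.
Proof.
  intros [A1 A2] Hs.
  assert (Hr := proj1 (Cmod_gt_0 (f t)) (slit_plane_neq_0 _ Hs)).
  apply slit_plane_pos in Hs.
  assert (E := Cmod2_alt (f t)).
  assert (Dr : is_derive (fun s => Cmod (f s)) t
                 ((Re (f t) * Re a + Im (f t) * Im a) / Cmod (f t))).
  { evar_last.
    - apply (is_derive_sqrt _ t _ (is_derive_sqnorm _ _ _ _ _ A1 A2)); rewrite <- E; nra.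
    - change (sqrt (Re (f t) ^ 2 + Im (f t) ^ 2)) with (Cmod (f t)); field; lra. }
  assert (N : (a / f t)%C =
    ((Re (f t) * Re a + Im (f t) * Im a) / (Cmod (f t) * Cmod (f t)),
     (Re (f t) * Im a - Im (f t) * Re a) / (Cmod (f t) * Cmod (f t)))).
  { replace (Cmod (f t) * Cmod (f t)) with (Re (f t) ^ 2 + Im (f t) ^ 2) by (rewrite <- E; ring).
    assert (0 < Re (f t) ^ 2 + Im (f t) ^ 2) by (rewrite <- E; nra).
    unfold Cdiv, Cinv; apply Ceq; simpl; unfold Re, Im in *; field; simpl in *; lra. }
  rewrite N; split; simpl.
  - evar_last; [apply (is_derive_comp ln (fun s => Cmod (f s)) t);
      [now apply is_derive_ln | exact Dr]|].
    unfold scal; simpl; unfold mult; simpl; field; lra.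
  - apply (is_derive_ext_loc (fun s => 2 * atan (Im (f s) / (Cmod (f s) + Re (f s))))).
    + assert (Hc : continuous (fun s => Cmod (f s) + Re (f s)) t).
      { apply (ex_derive_continuous (K := R_AbsRing) (V := R_NormedModule)).
        apply (ex_derive_plus (K := R_AbsRing) (V := R_NormedModule)); eexists; eassumption. }
      apply filterlim_locally with (eps := mkposreal _ Hs) in Hc.
      revert Hc; apply filter_imp; intros s Hb.
      rewrite Carg_atan; [reflexivity|].
      apply slit_plane_pos.
      unfold ball in Hb; simpl in Hb; unfold AbsRing_ball, abs, minus, plus, opp in Hb; simpl in Hb.
      apply Rabs_def2 in Hb; lra.
    + apply (is_derive_half_angle (fun s => Re (f s)) (fun s => Im (f s)) (fun s => Cmod (f s)));
        try assumption; lra.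
Qed.

Lemma is_Cderive_continuity f t a :
  is_Cderive f t a ->
  continuity_pt (fun s => Re (f s)) t /\ continuity_pt (fun s => Im (f s)) t.
Proof. intros [A B]; split; eapply is_derive_continuity_pt; eassumption. Qed.

(** The mean value theorem applied to the component of f in the direction d of its
    increment, minus |d| g. It replaces the integration of complex functions
    throughout: g plays the part of the integral of a bound of the derivative. *)
Lemma Cmean_value (f f' : R -> C) (g g' : R -> R) a b :
  a <= b ->
  (forall t, a <= t <= b -> is_Cderive f t (f' t)) ->
  (forall t, a <= t <= b -> is_derive g t (g' t)) ->
  (forall t, a <= t <= b -> Cmod (f' t) <= g' t) ->
  Cmod (f b - f a) <= g b - g a.
Proof.
  intros Hab Hf Hg Hle.
  destruct (Req_dec a b) as [<-|Hne].
  { replace (f a - f a)%C with (RtoC 0) by ring; rewrite Cmod_0; lra. }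
  (* Cauchy-Schwarz turns the modulus of f' into a bound for its component along d. *)
  set (d := (f b - f a)%C).
  set (h := fun t => Re d * Re (f t) + Im d * Im (f t)).
  destruct (MVT_cor2 (fun t => h t - Cmod d * g t)
      (fun t => Re d * Re (f' t) + Im d * Im (f' t) - Cmod d * g' t) a b ltac:(lra))
    as [c [E Hc]].
  { intros t Ht; apply is_derive_Reals; destruct (Hf t Ht) as [A B].
    apply (is_derive_minus (K := R_AbsRing) (V := R_NormedModule)).
    - apply (is_derive_plus (K := R_AbsRing) (V := R_NormedModule)).
      + now apply (is_derive_scal (fun t => Re (f t))).
      + now apply (is_derive_scal (fun t => Im (f t))).
    - apply (is_derive_scal g); now apply Hg. }
  destruct (MVT_cor2 g g' a b ltac:(lra)) as [c' [E' Hc']].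
  { intros t Ht; now apply is_derive_Reals, Hg. }
  assert (H0 : 0 <= g b - g a).
  { rewrite E'; apply Rmult_le_pos; [|lra].
    eapply Rle_trans; [apply Cmod_ge_0 | apply (Hle c')]; lra. }
  assert (Hd : h b - h a = Cmod d ^ 2).
  { rewrite Cmod2_alt; unfold h, d; simpl; unfold Re, Im; ring. }
  assert (Hcs : Re d * Re (f' c) + Im d * Im (f' c) <= Cmod d * Cmod (f' c)).
  { assert (A := Cmod_ge_Re (Cconj d * f' c)).
    rewrite Cmod_mult, Cmod_conj, Re_mult in A.
    change (Re (Cconj d)) with (Re d) in A; change (Im (Cconj d)) with (- Im d) in A; lra. }
  assert (Hp := Cmod_ge_0 d).
  specialize (Hle c ltac:(lra)).
  assert (Cmod d ^ 2 <= Cmod d * (g b - g a)).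
  { assert ((Re d * Re (f' c) + Im d * Im (f' c) - Cmod d * g' c) * (b - a) <= 0).
    { assert (Cmod d * Cmod (f' c) <= Cmod d * g' c) by (apply Rmult_le_compat_l; lra).
      nra. }
    lra. }
  destruct (Req_dec (Cmod d) 0) as [Z|Z]; [lra|].
  apply (Rmult_le_reg_l (Cmod d)); nra.
Qed.

(** * Midpoint Euler-Maclaurin summation of the logarithm *)

(** The Bernoulli terms of the summation formula, kept as a function of both x and q = 1 / v
    because x runs from 0 to 1 along each piece while v moves with it. *)
Fixpoint bernoulli_tail (x : R) (q : C) (N : nat) : C :=
  match N with
  | O => RtoC 0
  | S j => (bernoulli_tail x q j +
            RtoC (bern (S (S j)) x / (INR (S j) * INR (S (S j)))) * q ^ S j)%C
  end.

(** A primitive of - B_(N+1)(x) / ((N+1) v^(N+1)) when x and v grow at the same unit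
    speed: it is what N + 1 integrations by parts of log v against the Bernoulli
    polynomials leave behind. *)
Definition em_primitive (N : nat) (x : R) (v : C) : C :=
  (v * Clog v - v - RtoC (x - 1 / 2) * Clog v + bernoulli_tail x (/ v) N)%C.

Fixpoint sum_Clog (z : C) (n : nat) : C :=
  match n with
  | O => RtoC 0
  | S m => (sum_Clog z m + Clog (z + RtoC (INR m + 1 / 2)))%C
  end.

(** The remainder of Euler-Maclaurin summation, which equals the integral over
    [0, n + 1/2] of - B_(N+1)({u + 1/2}) / ((N+1) (z+u)^(N+1)). With this definition by
    boundary terms no integral has to be formed. *)
Definition em_remainder (N : nat) (z : C) (n : nat) : C :=
  (em_primitive N 1 (z + RtoC (INR n + 1 / 2)) - em_primitive N (1 / 2) z - sum_Clog z n)%C.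

Lemma is_Cderive_shift a t : is_Cderive (fun s => (a + RtoC s)%C) t 1.
Proof.
  apply (is_Cderive_ext (fun s => (a + RtoC s * 1)%C)); [intros s; ring|].
  apply is_Cderive_line.
Qed.

Lemma is_Cderive_eq f t l l' : is_Cderive f t l -> l = l' -> is_Cderive f t l'.
Proof. now intros H <-. Qed.

(** The sum telescopes: the derivative of the Bernoulli polynomial in one term cancels
    against the derivative of the power of q in the preceding one. *)
Lemma is_Cderive_bernoulli_tail N a t : (a + RtoC t)%C <> 0 ->
  is_Cderive (fun s => bernoulli_tail s (/ (a + RtoC s)) N) t
    (RtoC (bern 1 t) * / (a + RtoC t) -
     RtoC (bern (S N) t / INR (S N)) * (/ (a + RtoC t)) ^ S N)%C.
Proof.
  intros Hv; induction N as [|N IH].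
  - apply (is_Cderive_eq (fun _ => RtoC 0) t (RtoC 0)); [apply is_Cderive_const|].
    change (INR 1) with 1.
    replace (bern 1 t / 1) with (bern 1 t) by field.
    generalize (bern 1 t); intros b.
    rewrite Cpow_1_r. ring.
  - eapply is_Cderive_eq.
    + apply is_Cderive_plus; [exact IH|].
      apply is_Cderive_mult.
      * apply (is_Cderive_RtoC
          (fun s => bern (S (S N)) s / (INR (S N) * INR (S (S N)))) t
          (bern (S N) t / INR (S N))).
        apply (is_derive_ext (fun s => / (INR (S N) * INR (S (S N))) * bern (S (S N)) s));
          [intros s; apply Rmult_comm|].
        evar_last; [apply (is_derive_scal (bern (S (S N)))), is_derive_bern|].
        assert (INR (S N) <> 0) by (apply not_0_INR; lia).
        assert (INR (S (S N)) <> 0) by (apply not_0_INR; lia).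
        unfold scal; simpl; unfold mult; cbn -[INR]; field; split; assumption.
      * apply is_Cderive_pow, is_Cderive_inv; [apply is_Cderive_shift | exact Hv].
    + cbv beta; set (q := (/ (a + RtoC t))%C).
      assert (E : RtoC (bern (S (S N)) t / INR (S (S N))) =
         (RtoC (bern (S (S N)) t / (INR (S N) * INR (S (S N)))) * RtoC (INR (S N)))%C).
      { rewrite <- RtoC_mult; f_equal; field; split; apply not_0_INR; lia. }
      rewrite E; change (q ^ S (S N))%C with (q * (q * q ^ N))%C.
      change (q ^ S N)%C with (q * q ^ N)%C; ring.
Qed.

Lemma is_Cderive_em_primitive N a t : slit_plane (a + RtoC t)%C ->
  is_Cderive (fun s => em_primitive N s (a + RtoC s)) t
    (- (RtoC (bern (S N) t / INR (S N)) * (/ (a + RtoC t)) ^ S N))%C.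
Proof.
  intros Hs; assert (Hv := slit_plane_neq_0 _ Hs).
  assert (Dv := is_Cderive_shift a t).
  assert (Dl := is_Cderive_log _ _ _ Dv Hs).
  eapply is_Cderive_eq.
  - unfold em_primitive; apply is_Cderive_plus; [|now apply is_Cderive_bernoulli_tail].
    apply is_Cderive_minus; [apply is_Cderive_minus|].
    + apply is_Cderive_mult; [exact Dv | exact Dl].
    + exact Dv.
    + apply is_Cderive_mult; [|exact Dl].
      apply (is_Cderive_RtoC (fun s => s - 1 / 2) t 1); auto_derive; trivial; ring.
  - rewrite bern_deg1.
    match goal with |- context [Cmult (RtoC (bern _ _ / _)) ?y] =>
      generalize (Cmult (RtoC (bern (S N) t / INR (S N))) y) end.
    intros w; field; exact Hv.
Qed.

(** The polynomials of degree at least 2 take equal values at 0 and 1. *)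
Lemma bernoulli_tail_periodic q N : bernoulli_tail 1 q N = bernoulli_tail 0 q N.
Proof.
  induction N as [|N IH]; [reflexivity|].
  simpl bernoulli_tail; rewrite IH, (bern_1 (S (S N))) by lia; reflexivity.
Qed.

(** Only B_1 differs at 0 and 1. The jump that it causes at each half-integer is the
    summand that the remainder subtracts there. *)
Lemma em_primitive_jump N v : em_primitive N 1 v = (em_primitive N 0 v - Clog v)%C.
Proof.
  unfold em_primitive; rewrite bernoulli_tail_periodic.
  replace (1 - 1 / 2) with (1 + (0 - 1 / 2)) by field.
  rewrite (RtoC_plus 1 (0 - 1 / 2)); ring.
Qed.

Lemma Re_add_real z u : Re (z + RtoC u)%C = Re z + u.
Proof. reflexivity. Qed.

(** The contribution of the piece [n - 1/2 + t0, n + 1/2] of the half-line; t0 is 1/2 for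
    the first piece, which starts at 0, and 0 for all others. The function g stands for
    a primitive of a bound of the integrand; it will be chosen once sharp and once
    uniform in z. *)
Lemma em_piece k z n t0 (g g' : R -> R) :
  (1 <= k)%nat -> 0 <= Re z -> z <> 0 ->
  0 <= t0 <= 1 -> 0 <= INR n - 1 / 2 + t0 ->
  (forall u, INR n - 1 / 2 + t0 <= u <= INR n + 1 / 2 -> is_derive g u (g' u)) ->
  (forall u, INR n - 1 / 2 + t0 <= u <= INR n + 1 / 2 ->
     Rabs (bern (2 * k) 0) / INR (2 * k) * / Cmod (z + RtoC u)%C ^ (2 * k) <= g' u) ->
  Cmod (em_primitive (2 * k - 1) 1 (z + RtoC (INR n + 1 / 2)) -
        em_primitive (2 * k - 1) t0 (z + RtoC (INR n - 1 / 2 + t0)))%C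
  <= g (INR n + 1 / 2) - g (INR n - 1 / 2 + t0).
Proof.
  intros Hk Hz Hz0 Ht0 Hu0 Dg Hg.
  set (a := (z + RtoC (INR n - 1 / 2))%C).
  assert (Ea : forall t, (a + RtoC t)%C = (z + RtoC (INR n - 1 / 2 + t))%C).
  { intros t; unfold a; rewrite (RtoC_plus _ t); ring. }
  assert (Hslit : forall t, t0 <= t -> slit_plane (a + RtoC t)%C).
  { intros t Ht; apply slit_plane_half; rewrite Ea.
    - rewrite Re_add_real; lra.
    - intros E; assert (E1 := f_equal Re E); assert (E2 := f_equal Im E).
      simpl in E1, E2; apply Hz0, Ceq; simpl; unfold Re, Im in *; lra. }
  assert (Hbound := Cmean_value
    (fun s => em_primitive (2 * k - 1) s (a + RtoC s))
    (fun t => (- (RtoC (bern (S (2 * k - 1)) t / INR (S (2 * k - 1))) *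
               (/ (a + RtoC t)) ^ S (2 * k - 1)))%C)
    (fun t => g (INR n - 1 / 2 + t)) (fun t => g' (INR n - 1 / 2 + t)) t0 1 (proj2 Ht0)).
  cbv beta in Hbound.
  rewrite !Ea in Hbound; replace (INR n - 1 / 2 + 1) with (INR n + 1 / 2) in Hbound by field.
  apply Hbound; clear Hbound.
  - intros t Ht; apply is_Cderive_em_primitive, Hslit; lra.
  - intros t Ht; evar_last.
    + apply (is_derive_comp g (fun t => INR n - 1 / 2 + t)); [apply Dg; lra|].
      auto_derive; [trivial | reflexivity].
    + unfold scal; simpl; unfold mult; simpl; ring.
  - intros t Ht.
    assert (Hv := slit_plane_neq_0 _ (Hslit t (proj1 Ht))).
    replace (S (2 * k - 1)) with (2 * k)%nat by lia.
    rewrite Cmod_opp, Cmod_mult, Cmod_pow, Cmod_inv, Cmod_R by exact Hv.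
    rewrite pow_inv, Ea.
    eapply Rle_trans; [|apply Hg; lra].
    apply Rmult_le_compat_r.
    + left; apply Rinv_0_lt_compat, pow_lt, Cmod_gt_0; now rewrite <- Ea.
    + assert (0 < INR (2 * k)) by (apply lt_0_INR; lia).
      unfold Rdiv; rewrite Rabs_mult, (Rabs_pos_eq (/ _)) by (left; now apply Rinv_0_lt_compat).
      apply Rmult_le_compat_r; [left; now apply Rinv_0_lt_compat|].
      apply bern_even_bound; [assumption | lra].
Qed.

Lemma em_remainder_0 N z : em_remainder N z 0 =
  (em_primitive N 1 (z + RtoC (INR 0 + 1 / 2)) - em_primitive N (1 / 2) (z + RtoC (INR 0 - 1 / 2 + 1 / 2)))%C.
Proof.
  unfold em_remainder; simpl sum_Clog.
  replace (z + RtoC (INR 0 - 1 / 2 + 1 / 2))%C with z.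
  - ring.
  - replace (INR 0 - 1 / 2 + 1 / 2) with 0 by (simpl; field); ring.
Qed.

Lemma em_remainder_S N z n : (em_remainder N z (S n) - em_remainder N z n)%C =
  (em_primitive N 1 (z + RtoC (INR (S n) + 1 / 2)) -
   em_primitive N 0 (z + RtoC (INR (S n) - 1 / 2 + 0)))%C.
Proof.
  unfold em_remainder; simpl sum_Clog.
  replace (INR (S n) - 1 / 2 + 0) with (INR n + 1 / 2) by (rewrite S_INR; field).
  rewrite (em_primitive_jump N (z + RtoC (INR n + 1 / 2))); ring.
Qed.

Lemma Cmod_triangle_sub a b c : Cmod (a - c) <= Cmod (a - b) + Cmod (b - c).
Proof.
  replace (a - c)%C with ((a - b) + (b - c))%C by ring; apply Cmod_triangle.
Qed.

(** Equality holds on the imaginary axis, which is thus the worst case of the bound. *)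
Lemma Cmod_shift_sq z u : 0 <= Re z -> 0 <= u ->
  Cmod z ^ 2 + u ^ 2 <= Cmod (z + RtoC u) ^ 2.
Proof. intros Hz Hu; rewrite !Cmod2_alt; simpl; unfold Re, Im in *; nra. Qed.

(** The integral over u >= 0 of |B_2k| / (2k (|z|^2 + u^2)^k). *)
Definition remainder_bound (k : nat) (z : C) : R :=
  Rabs (bern (2 * k) 0) / INR (2 * k) / Cmod z ^ (2 * k - 1) * (PI / 2 * wallis (k - 1)).

(** Bounding |B_2k| by its value at 0 and |z + u|^2 from below by |z|^2 + u^2 gives an
    integrand whose primitive is a rescaled arctan_pow. *)
Lemma em_remainder_bound k z n :
  (1 <= k)%nat -> 0 <= Re z -> z <> 0 ->
  Cmod (em_remainder (2 * k - 1) z n) <= remainder_bound k z.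
Proof.
  intros Hk Hz Hz0.
  assert (Hr := proj1 (Cmod_gt_0 z) Hz0).
  assert (HK : 0 <= Rabs (bern (2 * k) 0) / INR (2 * k)).
  { apply Rmult_le_pos; [apply Rabs_pos|].
    left; apply Rinv_0_lt_compat, lt_0_INR; lia. }
  set (K := Rabs (bern (2 * k) 0) / INR (2 * k)) in *.
  set (r := Cmod z) in *.
  set (g := fun u => K / r ^ (2 * k - 1) * arctan_pow (k - 1) (u / r)).
  set (g' := fun u => K * / (r ^ 2 + u ^ 2) ^ k).
  assert (Hr1 : 0 < r ^ (2 * k - 1)) by now apply pow_lt.
  assert (Dg : forall u, is_derive g u (g' u)).
  { intros u; unfold g, g'; evar_last.
    - apply (is_derive_scal (fun u => arctan_pow (k - 1) (u / r))).
      apply (is_derive_comp (arctan_pow (k - 1)) (fun u => u / r));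
        [apply is_derive_arctan_pow|].
      auto_derive; [trivial | reflexivity].
    - unfold scal; simpl; unfold mult; simpl.
      replace (r * (r * 1) + u * (u * 1)) with (r ^ 2 * (1 + u / r * (u / r * 1))) by (field; lra).
      assert (0 < 1 + u / r * (u / r * 1)) by nra.
      destruct k as [|k]; [lia|].
      replace (S k - 1)%nat with k by lia.
      rewrite Rpow_mult_distr, <- pow_mult; change ((1 + u / r * (u / r * 1)) ^ S k) with
        ((1 + u / r * (u / r * 1)) * (1 + u / r * (u / r * 1)) ^ k).
      change (S k + (S k + 0) - 1)%nat with (2 * S k - 1)%nat in *.
      replace (r ^ (2 * S k)) with (r * r ^ (2 * S k - 1))
        by (rewrite tech_pow_Rmult; f_equal; lia).
      assert (0 < (1 + u / r * (u / r * 1)) ^ k) by now apply pow_lt.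
      set (y := 1 + u / r * (u / r * 1)) in *.
      field; repeat split; lra. }
  assert (Hg : forall u, 0 <= u -> K * / Cmod (z + RtoC u)%C ^ (2 * k) <= g' u).
  { intros u Hu; unfold g'; apply Rmult_le_compat_l; [assumption|].
    assert (0 < r ^ 2 + u ^ 2) by nra.
    apply Rinv_le_contravar; [now apply pow_lt|].
    rewrite pow_mult; apply pow_incr; split; [lra | now apply Cmod_shift_sq]. }
  assert (H : Cmod (em_remainder (2 * k - 1) z n) <= g (INR n + 1 / 2)).
  { induction n as [|n IH].
    - rewrite em_remainder_0.
      replace (g (INR 0 + 1 / 2)) with (g (INR 0 + 1 / 2) - g (INR 0 - 1 / 2 + 1 / 2)).
      + apply em_piece with (g' := g'); simpl INR; try assumption; try lra.
        * intros; apply Dg.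
        * intros u Hu; apply Hg; lra.
      + replace (INR 0 - 1 / 2 + 1 / 2) with 0 by (simpl; field).
        unfold g at 2; replace (0 / r) with 0 by (field; lra).
        rewrite arctan_pow_0; ring.
    - assert (P := pos_INR n).
      assert (A : Cmod (em_remainder (2 * k - 1) z (S n) - em_remainder (2 * k - 1) z n)
                  <= g (INR (S n) + 1 / 2) - g (INR n + 1 / 2)).
      { rewrite em_remainder_S.
        replace (INR n + 1 / 2) with (INR (S n) - 1 / 2 + 0) by (rewrite S_INR; field).
        apply em_piece with (g' := g'); rewrite ?S_INR; try assumption; try lra.
        - intros; apply Dg.
        - intros u Hu; apply Hg; lra. }
      replace (em_remainder (2 * k - 1) z (S n)) with
        ((em_remainder (2 * k - 1) z (S n) - em_remainder (2 * k - 1) z n) + em_remainder (2 * k - 1) z n)%C by ring.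
      eapply Rle_trans; [apply Cmod_triangle | lra]. }
  eapply Rle_trans; [exact H|].
  unfold g, remainder_bound; fold r; fold K.
  apply Rmult_le_compat_l; [|apply arctan_pow_le].
  apply Rmult_le_pos; [assumption | left; now apply Rinv_0_lt_compat].
Qed.

(** The constant K does not depend on z, although the bound of the remainder itself blows
    up as z tends to 0. This uniformity is used along a path in z. *)
Lemma em_remainder_cauchy k : (1 <= k)%nat -> exists K, 0 <= K /\
  forall z n p, 0 <= Re z -> z <> 0 -> (1 <= n)%nat ->
  Cmod (em_remainder (2 * k - 1) z (n + p) - em_remainder (2 * k - 1) z n) <= K / INR n.
Proof.
  intros Hk.
  assert (HK : 0 <= Rabs (bern (2 * k) 0) / INR (2 * k)).
  { apply Rmult_le_pos; [apply Rabs_pos|].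
    left; apply Rinv_0_lt_compat, lt_0_INR; lia. }
  set (K := Rabs (bern (2 * k) 0) / INR (2 * k)) in *.
  exists K; split; [assumption|].
  intros z n p Hz Hz0 Hn.
  set (g := fun u => - K / u).
  set (g' := fun u => K / u ^ 2).
  assert (Hn1 : 1 <= INR n) by (apply (le_INR 1), Hn).
  assert (Dg : forall u, 1 <= u -> is_derive g u (g' u)).
  { intros u Hu; unfold g, g'; auto_derive; [lra | field; lra]. }
  assert (Hg : forall u, 1 <= u -> K * / Cmod (z + RtoC u)%C ^ (2 * k) <= g' u).
  { intros u Hu; unfold g', Rdiv; apply Rmult_le_compat_l; [assumption|].
    apply Rinv_le_contravar; [nra|].
    assert (A : u <= Cmod (z + RtoC u)%C).
    { eapply Rle_trans; [|apply Cmod_ge_Re]; rewrite Re_add_real; lra. }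
    apply Rle_trans with (u ^ (2 * k)); [apply Rle_pow; [assumption | lia]|].
    apply pow_incr; lra. }
  assert (H : Cmod (em_remainder (2 * k - 1) z (n + p) - em_remainder (2 * k - 1) z n)
              <= g (INR (n + p) + 1 / 2) - g (INR n + 1 / 2)).
  { induction p as [|p IH].
    - rewrite Nat.add_0_r.
      replace (_ - _)%C with (RtoC 0) by ring; rewrite Cmod_0; lra.
    - rewrite Nat.add_succ_r.
      assert (P : INR n <= INR (n + p)) by (apply le_INR; lia).
      assert (A : Cmod (em_remainder (2 * k - 1) z (S (n + p)) - em_remainder (2 * k - 1) z (n + p))
                  <= g (INR (S (n + p)) + 1 / 2) - g (INR (n + p) + 1 / 2)).
      { rewrite em_remainder_S.
        replace (INR (n + p) + 1 / 2) with (INR (S (n + p)) - 1 / 2 + 0)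
          by (rewrite S_INR; field).
        apply em_piece with (g' := g'); rewrite ?(S_INR (n + p)); try assumption; try lra.
        - intros; apply Dg; lra.
        - intros u Hu; apply Hg; lra. }
      eapply Rle_trans; [apply (Cmod_triangle_sub _ (em_remainder (2 * k - 1) z (n + p)))|].
      lra. }
  eapply Rle_trans; [exact H|].
  assert (P : INR n <= INR (n + p)) by (apply le_INR; lia).
  unfold g.
  assert (0 <= K / (INR (n + p) + 1 / 2))
    by (apply Rmult_le_pos; [assumption | left; apply Rinv_0_lt_compat; lra]).
  assert (K / (INR n + 1 / 2) <= K / INR n)
    by (apply Rmult_le_compat_l; [assumption | apply Rinv_le_contravar; lra]).
  unfold Rdiv in *; lra.
Qed.

(** * Limits of sequences with a rate *)

Lemma INR_ge_1 n : (1 <= n)%nat -> 1 <= INR n.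
Proof. intros H; apply (le_INR 1), H. Qed.

Lemma is_lim_seq_div_n K : is_lim_seq (fun n => K / INR n) 0.
Proof.
  evar_last.
  - apply (is_lim_seq_mult' (fun _ => K) (fun n => / INR n)); [apply is_lim_seq_const|].
    apply (is_lim_seq_inv _ p_infty); [apply is_lim_seq_INR | easy].
  - simpl; f_equal; ring.
Qed.

Lemma Rseq_limit (u : nat -> R) K : 0 <= K ->
  (forall n p, (1 <= n)%nat -> Rabs (u (n + p)%nat - u n) <= K / INR n) ->
  exists l : R, is_lim_seq u l /\ forall n, (1 <= n)%nat -> Rabs (u n - l) <= K / INR n.
Proof.
  intros HK H.
  assert (Hex : ex_finite_lim_seq u).
  { apply ex_lim_seq_cauchy_corr; intros eps.
    assert (L := is_lim_seq_div_n (2 * K)); apply is_lim_seq_spec in L.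
    destruct (L eps) as [N HN].
    exists (S N); intros n m Hn Hm.
    assert (A := H (S N) (n - S N)%nat ltac:(lia)).
    assert (B := H (S N) (m - S N)%nat ltac:(lia)).
    replace (S N + (n - S N))%nat with n in A by lia.
    replace (S N + (m - S N))%nat with m in B by lia.
    specialize (HN (S N) ltac:(lia)).
    rewrite Rminus_0_r in HN; apply Rabs_def2 in HN.
    replace (2 * K / INR (S N)) with (K / INR (S N) + K / INR (S N)) in HN
      by (unfold Rdiv; ring).
    apply Rabs_le_between in A; apply Rabs_le_between in B.
    apply Rabs_def1; lra. }
  destruct Hex as [l Hl]; exists l; split; [exact Hl|].
  intros n Hn.
  assert (L : is_lim_seq (fun p => Rabs (u n - u (p + n)%nat)) (Rabs (u n - l))).
  { apply (is_lim_seq_abs _ (u n - l)).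
    apply is_lim_seq_minus'; [apply is_lim_seq_const|].
    now apply (is_lim_seq_incr_n u n l). }
  apply (is_lim_seq_le (fun p => Rabs (u n - u (p + n)%nat)) (fun _ => K / INR n)
           (Rabs (u n - l)) (K / INR n));
    [|exact L | apply is_lim_seq_const].
  intros p; rewrite Rabs_minus_sym, Nat.add_comm; now apply H.
Qed.

(** The factor 2 pays for passing through the two components. *)
Lemma Cseq_limit (s : nat -> C) K : 0 <= K ->
  (forall n p, (1 <= n)%nat -> Cmod (s (n + p)%nat - s n) <= K / INR n) ->
  exists l : C, forall n, (1 <= n)%nat -> Cmod (s n - l) <= 2 * K / INR n.
Proof.
  intros HK H.
  destruct (Rseq_limit (fun n => Re (s n)) K HK) as [x [_ Hx]].
  { intros n p Hn; rewrite <- Re_minus.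
    eapply Rle_trans; [apply re_le_Cmod | now apply H]. }
  destruct (Rseq_limit (fun n => Im (s n)) K HK) as [y [_ Hy]].
  { intros n p Hn; rewrite <- Im_minus.
    eapply Rle_trans; [apply Im_abs_le | now apply H]. }
  exists (x, y); intros n Hn.
  eapply Rle_trans; [apply Cmod_le_abs|].
  rewrite Re_minus, Im_minus; simpl.
  specialize (Hx n Hn); specialize (Hy n Hn); unfold Re, Im in *; simpl.
  replace (2 * K / INR n) with (K / INR n + K / INR n) by (unfold Rdiv; ring); lra.
Qed.

(** * Gauss's products and their logarithms *)

Lemma bernoulli_tail_small N x : exists M, 0 <= M /\
  forall q, Cmod q <= 1 -> Cmod (bernoulli_tail x q N) <= M * Cmod q.
Proof.
  induction N as [|N [M [HM H]]].
  - exists 0; split; [lra|]; intros q _; simpl; rewrite Cmod_0; lra.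
  - set (c := bern (S (S N)) x / (INR (S N) * INR (S (S N)))).
    assert (Hc := Rabs_pos c).
    exists (M + Rabs c); split; [lra|]; intros q Hq.
    specialize (H q Hq); assert (Hq0 := Cmod_ge_0 q).
    change (bernoulli_tail x q (S N)) with (bernoulli_tail x q N + RtoC c * q ^ S N)%C.
    eapply Rle_trans; [apply Cmod_triangle|].
    rewrite Cmod_mult, Cmod_R.
    assert (Cmod (q * q ^ N) <= Cmod q).
    { rewrite Cmod_mult, Cmod_pow.
      assert (Cmod q ^ N <= 1) by (rewrite <- (pow1 N); apply pow_incr; lra).
      assert (0 <= Cmod q ^ N) by now apply pow_le.
      nra. }
    change (q ^ S N)%C with (q * q ^ N)%C.
    assert (Rabs c * Cmod (q * q ^ N) <= Rabs c * Cmod q) by now apply Rmult_le_compat_l.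
    lra.
Qed.

(** The logarithm of Gauss's product at z + 1/2, with each factor given its principal
    logarithm. *)
Definition log_Gamma_seq (n : nat) (z : C) : C :=
  (RtoC (ln (INR (fact n))) + (z + RtoC (1 / 2)) * RtoC (ln (INR n)) - sum_Clog z (S n))%C.

(** What the logarithm of Gauss's product contains besides the expansion, its remainder
    and the Bernoulli terms at v = z + n + 1/2. It tends to ln (2 PI) / 2. *)
Definition stirling_part (n : nat) (z : C) : C :=
  (RtoC (ln (INR (fact n))) + (z + RtoC (1 / 2)) * RtoC (ln (INR n)) -
   RtoC (1 / 2) * Clog (z + RtoC (INR n + 1 / 2)) -
   (z + RtoC (INR n + 1 / 2)) * Clog (z + RtoC (INR n + 1 / 2)) +
   (z + RtoC (INR n + 1 / 2)))%C.

(** Euler-Maclaurin summation, solved for the logarithm of Gauss's product. On the right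
    the first term tends to ln (2 PI) / 2, the second to 0, the third is the expansion
    to be proved, and the last tends to its remainder. *)
Lemma log_Gamma_seq_em N n z : log_Gamma_seq n z =
  (stirling_part n z - bernoulli_tail 1 (/ (z + RtoC (INR n + 1 / 2))) N +
   em_primitive N (1 / 2) z + em_remainder N z n)%C.
Proof.
  unfold log_Gamma_seq, stirling_part, em_remainder; simpl sum_Clog; unfold em_primitive at 2.
  replace (1 - 1 / 2) with (1 / 2) by field.
  generalize (em_primitive N (1 / 2) z); intros e.
  generalize (Clog (z + RtoC (INR n + 1 / 2))); intros lv.
  generalize (bernoulli_tail 1 (/ (z + RtoC (INR n + 1 / 2))) N); intros tl.
  generalize (RtoC (INR n + 1 / 2)); intros h.
  assert (E : RtoC 1 = (RtoC (1 / 2) + RtoC (1 / 2))%C) by (rewrite <- RtoC_plus; f_equal; field).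
  transitivity (RtoC (ln (INR (fact n))) + (z + RtoC (1 / 2)) * RtoC (ln (INR n)) -
    (sum_Clog z n + (RtoC (1 / 2) + RtoC (1 / 2)) * lv))%C; [rewrite <- E; ring|].
  generalize (RtoC (1 / 2)); intros c; ring.
Qed.

Lemma Cexp_sum_Clog z n : 0 <= Re z ->
  Cexp (sum_Clog z n) = Crising (z + RtoC (1 / 2)) n.
Proof.
  intros Hz; induction n as [|n IH]; simpl sum_Clog.
  - rewrite Cexp_RtoC, exp_0; reflexivity.
  - assert (H := pos_INR n).
    rewrite Cexp_plus, IH, Cexp_Clog.
    + simpl; rewrite RtoC_plus; ring.
    + apply Re_pos_neq_0; rewrite Re_add_real; lra.
Qed.

Lemma Cexp_log_Gamma_seq n z : 0 <= Re z ->
  Cexp (log_Gamma_seq n z) = Gamma_seq (z + RtoC (1 / 2)) n.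
Proof.
  intros Hz; unfold log_Gamma_seq, Gamma_seq, Cminus.
  rewrite !Cexp_plus, Cexp_opp, Cexp_sum_Clog, Cexp_RtoC, exp_ln by
    (try assumption; apply INR_fact_lt_0).
  reflexivity.
Qed.

Lemma Clog_near_real (x : R) (v : C) : 0 < x -> x <= Re v ->
  Cmod (Clog v - RtoC (ln x)) <= Cmod (v - RtoC x) / x.
Proof.
  intros Hx Hv.
  set (b := (v - RtoC x)%C).
  assert (Hb : 0 <= Re b) by (unfold b; rewrite Re_minus, Re_RtoC; lra).
  assert (Hre : forall t, 0 <= t -> x <= Re (RtoC x + RtoC t * b)%C).
  { intros t Ht; rewrite Re_plus, Re_mult, !Re_RtoC, Im_RtoC; nra. }
  assert (H := Cmean_value (fun t => Clog (RtoC x + RtoC t * b)%C)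
     (fun t => (b / (RtoC x + RtoC t * b))%C)
     (fun t => t * (Cmod b / x)) (fun _ => Cmod b / x) 0 1 Rle_0_1).
  cbv beta in H.
  replace (RtoC x + RtoC 1 * b)%C with v in H by (unfold b; ring).
  replace (RtoC x + RtoC 0 * b)%C with (RtoC x) in H by ring.
  rewrite Clog_RtoC in H by assumption.
  replace (Cmod b / x) with (1 * (Cmod b / x) - 0 * (Cmod b / x)) by ring.
  apply H.
  - intros t Ht; apply is_Cderive_log; [apply is_Cderive_line|].
    specialize (Hre t (proj1 Ht)).
    apply slit_plane_half; [lra | apply Re_pos_neq_0; lra].
  - intros t _; auto_derive; [trivial | ring].
  - intros t Ht; specialize (Hre t (proj1 Ht)).
    assert (A := Cmod_ge_Re (RtoC x + RtoC t * b)%C).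
    rewrite Cmod_div by (apply Re_pos_neq_0; lra).
    unfold Rdiv; apply Rmult_le_compat_l; [apply Cmod_ge_0|].
    apply Rinv_le_contravar; lra.
Qed.

(** The derivative in z is ln n - log v - 1/(2v) with v = z + n + 1/2, which is of order
    1/n. The limit can therefore be computed at one point, and 1/2 is the point where
    factorials appear. *)
Lemma stirling_part_variation n z : (1 <= n)%nat -> 0 <= Re z ->
  Cmod (stirling_part n z - stirling_part n (RtoC (1 / 2))) <=
  Cmod (z - RtoC (1 / 2)) * (Cmod z + 2) / INR n.
Proof.
  intros Hn Hz; assert (Hn1 := INR_ge_1 n Hn).
  set (b := (z - RtoC (1 / 2))%C).
  set (p := fun t : R => (RtoC (1 / 2) + RtoC t * b)%C).
  set (v := fun t : R => (p t + RtoC (INR n + 1 / 2))%C).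
  assert (Hp : forall t, 0 <= t <= 1 -> 0 <= Re (p t) /\ Cmod (p t) <= Cmod z + 1 / 2).
  { intros t Ht.
    assert (Ep : p t = (RtoC ((1 - t) * (1 / 2)) + RtoC t * z)%C).
    { unfold p, b; rewrite RtoC_mult, RtoC_minus; ring. }
    rewrite Ep; split.
    - rewrite Re_plus, Re_mult, !Re_RtoC, Im_RtoC; nra.
    - eapply Rle_trans; [apply Cmod_triangle|].
      rewrite Cmod_mult, !Cmod_R, !Rabs_pos_eq by nra.
      assert (P := Cmod_ge_0 z); nra. }
  assert (Dp : forall t, is_Cderive p t b) by (intros t; apply is_Cderive_line).
  assert (Dv : forall t, is_Cderive v t b).
  { intros t; eapply is_Cderive_eq;
      [apply is_Cderive_plus; [apply Dp | apply is_Cderive_const] | ring]. }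
  assert (Hv : forall t, 0 <= t <= 1 -> INR n + 1 / 2 <= Re (v t)).
  { intros t Ht; destruct (Hp t Ht); unfold v; rewrite Re_add_real; lra. }
  assert (Hs : forall t, 0 <= t <= 1 -> slit_plane (v t)).
  { intros t Ht; specialize (Hv t Ht).
    apply slit_plane_half; [lra | apply Re_pos_neq_0; lra]. }
  set (G := Cmod b * (Cmod z + 2) / INR n).
  assert (H := Cmean_value (fun t => stirling_part n (p t))
     (fun t => (b * (RtoC (ln (INR n)) - Clog (v t) - RtoC (1 / 2) / v t))%C)
     (fun t => t * G) (fun _ => G) 0 1 Rle_0_1).
  cbv beta in H.
  replace (p 1) with z in H by (unfold p, b; ring).
  replace (p 0) with (RtoC (1 / 2)) in H by (unfold p, b; ring).
  replace G with (1 * G - 0 * G) by ring.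
  apply H; clear H.
  - intros t Ht; specialize (Hs t Ht).
    assert (Hv0 := slit_plane_neq_0 _ Hs).
    assert (Dl := is_Cderive_log _ _ _ (Dv t) Hs).
    eapply is_Cderive_eq.
    + unfold stirling_part; apply is_Cderive_plus; [|exact (Dv t)].
      apply is_Cderive_minus; [apply is_Cderive_minus; [apply is_Cderive_plus|]|].
      * apply is_Cderive_const.
      * apply is_Cderive_mult; [|apply is_Cderive_const].
        apply is_Cderive_plus; [apply Dp | apply is_Cderive_const].
      * apply is_Cderive_mult; [apply is_Cderive_const | exact Dl].
      * apply is_Cderive_mult; [exact (Dv t) | exact Dl].
    + cbv beta; change (p t + RtoC (INR n + 1 / 2))%C with (v t).
      generalize (Clog (v t)); intros lv; generalize (RtoC (1 / 2)); intros c.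
      field; exact Hv0.
  - intros t _; auto_derive; [trivial | ring].
  - intros t Ht; specialize (Hv t Ht); destruct (Hp t Ht) as [Hp1 Hp2].
    assert (A := Clog_near_real (INR n) (v t) ltac:(lra) ltac:(lra)).
    assert (B : Cmod (v t - RtoC (INR n)) <= Cmod z + 1).
    { replace (v t - RtoC (INR n))%C with (p t + RtoC (1 / 2))%C
        by (unfold v; rewrite RtoC_plus; ring).
      eapply Rle_trans; [apply Cmod_triangle|].
      rewrite Cmod_R, Rabs_pos_eq by lra; lra. }
    assert (D : Cmod (RtoC (1 / 2) / v t) <= 1 / INR n).
    { rewrite Cmod_div by (apply Re_pos_neq_0; lra).
      rewrite Cmod_R, Rabs_pos_eq by lra.
      assert (INR n <= Cmod (v t)) by (eapply Rle_trans; [|apply Cmod_ge_Re]; lra).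
      unfold Rdiv; apply Rmult_le_compat; try lra.
      - left; apply Rinv_0_lt_compat; lra.
      - apply Rinv_le_contravar; lra. }
    unfold G, Rdiv; rewrite Cmod_mult, Rmult_assoc.
    apply Rmult_le_compat_l; [apply Cmod_ge_0|].
    eapply Rle_trans; [apply Cmod_triangle|].
    rewrite Cmod_opp, Cmod_dist_sym.
    assert (I : 0 < / INR n) by (apply Rinv_0_lt_compat; lra).
    unfold Rdiv in *.
    assert (Cmod (v t - RtoC (INR n)) * / INR n <= (Cmod z + 1) * / INR n)
      by (apply Rmult_le_compat_r; lra).
    lra.
Qed.

Lemma stirling_part_half n : (1 <= n)%nat ->
  stirling_part n (RtoC (1 / 2)) =
  RtoC (stirling_defect (S n) + (ln (INR n) - ln (INR (S n)))).
Proof.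
  intros Hn; assert (Hn1 := INR_ge_1 n Hn).
  unfold stirling_part.
  replace (RtoC (1 / 2) + RtoC (INR n + 1 / 2))%C with (RtoC (INR (S n)))
    by (rewrite <- RtoC_plus, S_INR; f_equal; field).
  rewrite Clog_RtoC by (apply lt_0_INR; lia).
  repeat (rewrite <- RtoC_plus || rewrite <- RtoC_mult || rewrite <- RtoC_minus).
  f_equal; unfold stirling_defect.
  rewrite fact_simpl, mult_INR, ln_mult by
    (try apply INR_fact_lt_0; apply lt_0_INR; lia).
  rewrite S_INR; field.
Qed.

Lemma sum_Clog_half n : sum_Clog (RtoC (1 / 2)) n = RtoC (ln (INR (fact n))).
Proof.
  induction n as [|n IH]; simpl sum_Clog.
  - simpl; now rewrite ln_1.
  - replace (RtoC (1 / 2) + RtoC (INR n + 1 / 2))%C with (RtoC (INR (S n)))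
      by (rewrite <- RtoC_plus, S_INR; f_equal; field).
    rewrite IH, Clog_RtoC by (apply lt_0_INR; lia).
    rewrite <- RtoC_plus; f_equal.
    rewrite fact_simpl, mult_INR, ln_mult by
      (try apply INR_fact_lt_0; apply lt_0_INR; lia); ring.
Qed.

Lemma bernoulli_tail_point_small N x : exists M, 0 <= M /\
  forall z n, 0 <= Re z -> (1 <= n)%nat ->
  Cmod (bernoulli_tail x (/ (z + RtoC (INR n + 1 / 2))) N) <= M / INR n.
Proof.
  destruct (bernoulli_tail_small N x) as [M [HM H]]; exists M; split; [exact HM|].
  intros z n Hz Hn; assert (Hn1 := INR_ge_1 n Hn).
  set (v := (z + RtoC (INR n + 1 / 2))%C).
  assert (Hv : INR n <= Cmod v).
  { eapply Rle_trans; [|apply Cmod_ge_Re]; unfold v; rewrite Re_add_real; lra. }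
  assert (Hq : Cmod (/ v) <= / INR n).
  { rewrite Cmod_inv by (apply Cmod_gt_0; lra); apply Rinv_le_contravar; lra. }
  assert (/ INR n <= 1) by (rewrite <- Rinv_1; apply Rinv_le_contravar; lra).
  eapply Rle_trans; [apply H; lra|].
  unfold Rdiv; now apply Rmult_le_compat_l.
Qed.

(** At z = 1/2 the sum of logarithms is ln n!, and the convergence of the remainder there
    is the convergence of the defect. *)
Lemma stirling_defect_lim : is_lim_seq stirling_defect (1 / 2 * ln (2 * PI)).
Proof.
  assert (Hhalf : 0 <= Re (RtoC (1 / 2))) by (simpl; lra).
  assert (Hhalf0 : RtoC (1 / 2) <> 0) by (intros E; apply RtoC_inj in E; lra).
  destruct (em_remainder_cauchy 1 (le_n 1)) as [K [HK Hc]].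
  destruct (Rseq_limit (fun n => Re (em_remainder 1 (RtoC (1 / 2)) n)) K HK) as [l [Hl _]].
  { intros n p Hn; rewrite <- Re_minus.
    eapply Rle_trans; [apply re_le_Cmod | now apply (Hc (RtoC (1 / 2)))]. }
  destruct (bernoulli_tail_point_small 1 1) as [M [HM Ht]].
  set (c := Re (em_primitive 1 (1 / 2) (RtoC (1 / 2)))).
  assert (E : forall n, (1 <= n)%nat -> stirling_defect (S n) =
     Re (bernoulli_tail 1 (/ (RtoC (1 / 2) + RtoC (INR n + 1 / 2))) 1) - c -
     Re (em_remainder 1 (RtoC (1 / 2)) n)).
  { intros n Hn; unfold em_remainder; rewrite sum_Clog_half.
    unfold em_primitive at 1.
    replace (RtoC (1 / 2) + RtoC (INR n + 1 / 2))%C with (RtoC (INR (S n)))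
      by (rewrite <- RtoC_plus, S_INR; f_equal; field).
    rewrite Clog_RtoC by (apply lt_0_INR; lia).
    rewrite !Re_minus, Re_plus, !Re_minus, !Re_mult, !Re_RtoC, !Im_RtoC.
    fold c; unfold stirling_defect.
    rewrite fact_simpl, mult_INR, ln_mult by
      (try apply INR_fact_lt_0; apply lt_0_INR; lia).
    rewrite S_INR; field. }
  assert (L : is_lim_seq stirling_defect (0 - c - l)).
  { apply is_lim_seq_incr_1.
    eapply is_lim_seq_ext_loc; [exists 1%nat; intros n Hn; symmetry; now apply E|].
    apply is_lim_seq_minus'; [apply is_lim_seq_minus'|]; [|apply is_lim_seq_const | exact Hl].
    apply is_lim_seq_abs_0.
    apply (is_lim_seq_le_le_loc (fun _ => 0) _ (fun n => M / INR n));
      [|apply is_lim_seq_const | apply is_lim_seq_div_n].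
    exists 1%nat; intros n Hn; split; [apply Rabs_pos|].
    eapply Rle_trans; [apply re_le_Cmod | now apply Ht]. }
  now rewrite <- (stirling_limit _ L).
Qed.

Definition stirling_error (n : nat) : R :=
  stirling_defect (S n) + (ln (INR n) - ln (INR (S n))) - 1 / 2 * ln (2 * PI).

Lemma stirling_error_lim : is_lim_seq stirling_error 0.
Proof.
  assert (L : is_lim_seq (fun n => ln (INR n) - ln (INR (S n))) 0).
  { apply is_lim_seq_abs_0.
    apply (is_lim_seq_le_le_loc (fun _ => 0) _ (fun n => 1 / INR n));
      [|apply is_lim_seq_const | apply is_lim_seq_div_n].
    exists 1%nat; intros n Hn; split; [apply Rabs_pos|].
    assert (Hn1 := INR_ge_1 n Hn).
    assert (A := Clog_near_real (INR n) (RtoC (INR (S n)))).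
    rewrite Clog_RtoC in A by (apply lt_0_INR; lia).
    rewrite <- !RtoC_minus, !Cmod_R in A.
    rewrite (Rabs_minus_sym (ln (INR n))); rewrite Re_RtoC, S_INR in *.
    eapply Rle_trans; [apply A; lra|].
    replace (INR n + 1 - INR n) with 1 by ring; rewrite Rabs_R1; lra. }
  unfold stirling_error; evar_last.
  - apply is_lim_seq_minus'; [apply is_lim_seq_plus'|].
    + apply (is_lim_seq_incr_1 stirling_defect), stirling_defect_lim.
    + exact L.
    + apply is_lim_seq_const.
  - f_equal; ring.
Qed.

Lemma Rle_of_lim a b K : (forall n, (1 <= n)%nat -> a <= b + K / INR n) -> a <= b.
Proof.
  intros H.
  apply (is_lim_seq_le (fun _ => a) (fun n => b + K / INR (S n)) a b).
  - intros n; apply H; lia.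
  - apply is_lim_seq_const.
  - replace (Finite b) with (Finite (b + 0)) by (f_equal; ring).
    apply is_lim_seq_plus'; [apply is_lim_seq_const|].
    apply (is_lim_seq_incr_1 (fun n => K / INR n)), is_lim_seq_div_n.
Qed.

(** Stirling's expansion of the logarithm of Gamma (z + 1/2) up to the term of index k; the
    Bernoulli terms appear in this form by bernoulli_tail_half. *)
Definition stirling_expansion (k : nat) (z : C) : C :=
  (RtoC (1 / 2 * ln (2 * PI)) + em_primitive (2 * k - 1) (1 / 2) z)%C.

(** The error e is the same for all z in a half-disc, which is what makes a single n
    suffice for a whole path. *)
Lemma log_Gamma_seq_uniform k M : (1 <= k)%nat -> exists e : nat -> R,
  is_lim_seq e 0 /\
  forall z, 0 <= Re z -> z <> 0 -> Cmod z <= M ->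
  exists l, Cmod l <= remainder_bound k z /\
    forall n, (1 <= n)%nat -> Cmod (log_Gamma_seq n z - (stirling_expansion k z + l)) <= e n.
Proof.
  intros Hk.
  destruct (em_remainder_cauchy k Hk) as [K [HK Hc]].
  destruct (bernoulli_tail_point_small (2 * k - 1) 1) as [T [HT Ht]].
  set (A := (M + 1 / 2) * (M + 2) + T + 2 * K).
  exists (fun n => Rabs (stirling_error n) + A / INR n); split.
  { evar_last.
    - apply is_lim_seq_plus'; [apply -> is_lim_seq_abs_0; apply stirling_error_lim |
        apply is_lim_seq_div_n].
    - f_equal; ring. }
  intros z Hz Hz0 HM; assert (P := Cmod_ge_0 z).
  destruct (Cseq_limit (em_remainder (2 * k - 1) z) K HK) as [l Hl].
  { intros n p Hn; now apply Hc. }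
  exists l; split.
  - apply (Rle_of_lim _ _ (2 * K)); intros n Hn.
    assert (B := em_remainder_bound k z n Hk Hz Hz0); specialize (Hl n Hn).
    replace l with (em_remainder (2 * k - 1) z n - (em_remainder (2 * k - 1) z n - l))%C by ring.
    eapply Rle_trans; [apply Cmod_triangle|]; rewrite Cmod_opp; lra.
  - intros n Hn; specialize (Hl n Hn); specialize (Ht z n Hz Hn).
    assert (Hn1 := INR_ge_1 n Hn).
    assert (V := stirling_part_variation n z Hn Hz).
    rewrite (log_Gamma_seq_em (2 * k - 1)); unfold stirling_expansion.
    set (tl := bernoulli_tail 1 (/ (z + RtoC (INR n + 1 / 2))) (2 * k - 1)) in *.
    rewrite stirling_part_half in V by assumption.
    set (d := stirling_defect (S n) + (ln (INR n) - ln (INR (S n)))) in *.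
    replace (_ - _)%C with
      (((stirling_part n z - RtoC d) + (RtoC d - RtoC (1 / 2 * ln (2 * PI)))) +
       ((- tl) + (em_remainder (2 * k - 1) z n - l)))%C by ring.
    eapply Rle_trans; [apply Cmod_triangle|].
    assert (B1 := Cmod_triangle (stirling_part n z - RtoC d)
                    (RtoC d - RtoC (1 / 2 * ln (2 * PI)))).
    assert (B2 := Cmod_triangle (- tl) (em_remainder (2 * k - 1) z n - l)).
    rewrite Cmod_opp in B2.
    rewrite <- RtoC_minus, Cmod_R in B1.
    change (d - 1 / 2 * ln (2 * PI)) with (stirling_error n) in B1.
    assert (B3 : Cmod (z - RtoC (1 / 2)) <= M + 1 / 2).
    { eapply Rle_trans; [apply Cmod_triangle|].
      rewrite Cmod_opp, Cmod_R, Rabs_pos_eq by lra; lra. }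
    assert (B4 : Cmod (z - RtoC (1 / 2)) * (Cmod z + 2) <= (M + 1 / 2) * (M + 2))
      by (apply Rmult_le_compat; try lra; apply Cmod_ge_0).
    assert (I : 0 < / INR n) by (apply Rinv_0_lt_compat; lra).
    assert (B5 : Cmod (z - RtoC (1 / 2)) * (Cmod z + 2) / INR n <= (M + 1 / 2) * (M + 2) / INR n)
      by (apply Rmult_le_compat_r; lra).
    rewrite <- RtoC_minus; change (d - 1 / 2 * ln (2 * PI)) with (stirling_error n).
    unfold A; rewrite !Rdiv_plus_distr; lra.
Qed.

(** Gauss's products are the exponentials of log_Gamma_seq, and the exponential is
    continuous. *)
Lemma Cexp_lim_CGamma z F e : 0 <= Re z -> is_lim_seq e 0 ->
  (forall n, (1 <= n)%nat -> Cmod (log_Gamma_seq n z - F) <= e n) ->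
  CGamma (z + RtoC (1 / 2)) = Cexp F.
Proof.
  intros Hz He H.
  assert (LR : is_lim_seq (fun n => Re (log_Gamma_seq n z)) (Re F)).
  { apply (is_lim_seq_ext (fun n => Re (log_Gamma_seq n z - F) + Re F));
      [intros n; rewrite Re_minus; ring|].
    replace (Finite (Re F)) with (Finite (0 + Re F)) by (f_equal; ring).
    apply is_lim_seq_plus'; [|apply is_lim_seq_const].
    apply is_lim_seq_abs_0.
    apply (is_lim_seq_le_le_loc (fun _ => 0) _ e); [|apply is_lim_seq_const | exact He].
    exists 1%nat; intros n Hn; split; [apply Rabs_pos|].
    eapply Rle_trans; [apply re_le_Cmod | now apply H]. }
  assert (LI : is_lim_seq (fun n => Im (log_Gamma_seq n z)) (Im F)).
  { apply (is_lim_seq_ext (fun n => Im (log_Gamma_seq n z - F) + Im F));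
      [intros n; rewrite Im_minus; ring|].
    replace (Finite (Im F)) with (Finite (0 + Im F)) by (f_equal; ring).
    apply is_lim_seq_plus'; [|apply is_lim_seq_const].
    apply is_lim_seq_abs_0.
    apply (is_lim_seq_le_le_loc (fun _ => 0) _ e); [|apply is_lim_seq_const | exact He].
    exists 1%nat; intros n Hn; split; [apply Rabs_pos|].
    eapply Rle_trans; [apply Im_abs_le | now apply H]. }
  assert (Lexp := is_lim_seq_continuous exp _ _
    (derivable_continuous_pt _ _ (derivable_pt_exp (Re F))) LR).
  assert (Lcos := is_lim_seq_continuous cos _ _
    (derivable_continuous_pt _ _ (derivable_pt_cos (Im F))) LI).
  assert (Lsin := is_lim_seq_continuous sin _ _
    (derivable_continuous_pt _ _ (derivable_pt_sin (Im F))) LI).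
  apply Ceq.
  - change (real (Lim_seq (fun n => Re (Gamma_seq (z + RtoC (1 / 2)) n))) = Re (Cexp F)).
    rewrite (is_lim_seq_unique _ (Re (Cexp F))); [reflexivity|].
    apply (is_lim_seq_ext (fun n => exp (Re (log_Gamma_seq n z)) * cos (Im (log_Gamma_seq n z)))).
    + intros n; rewrite <- Cexp_log_Gamma_seq by assumption; reflexivity.
    + now apply is_lim_seq_mult'.
  - change (real (Lim_seq (fun n => Im (Gamma_seq (z + RtoC (1 / 2)) n))) = Im (Cexp F)).
    rewrite (is_lim_seq_unique _ (Im (Cexp F))); [reflexivity|].
    apply (is_lim_seq_ext (fun n => exp (Re (log_Gamma_seq n z)) * sin (Im (log_Gamma_seq n z)))).
    + intros n; rewrite <- Cexp_log_Gamma_seq by assumption; reflexivity.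
    + now apply is_lim_seq_mult'.
Qed.

(** * The branch of the logarithm of Gamma *)

Lemma ex_derive_Cmod_continuous (L : C -> C) (w : C) :
  ex_derive (K := C_AbsRing) (V := C_NormedModule) L w ->
  forall eps, 0 < eps -> exists d, 0 < d /\
    forall w', Cmod (w' - w) < d -> Cmod (L w' - L w) < eps.
Proof.
  intros H eps Heps.
  apply ex_derive_continuous in H.
  assert (A := proj1 (filterlim_locally L (L w)) H (mkposreal (eps / 2) ltac:(lra))).
  destruct A as [d Hd]; exists d; split; [apply cond_pos|].
  intros w' Hw; destruct (Hd w' Hw) as [A B].
  eapply Rle_lt_trans; [apply Cmod_le_abs|]; rewrite Re_minus, Im_minus.
  change (Rabs (Re (L w') - Re (L w)) < eps / 2) in A.
  change (Rabs (Im (L w') - Im (L w)) < eps / 2) in B.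
  lra.
Qed.

(** The continuity by which the branch of L is followed along a path. *)
Lemma Im_path_continuity (L : C -> C) (f : R -> C) (t : R) (a : C) :
  ex_derive (K := C_AbsRing) (V := C_NormedModule) L (f t) ->
  is_Cderive f t a -> continuity_pt (fun s => Im (L (f s))) t.
Proof.
  intros HL Df eps Heps.
  destruct (ex_derive_Cmod_continuous L (f t) HL eps Heps) as [d [Hd H]].
  destruct (is_Cderive_continuity _ _ _ Df) as [CR CI].
  destruct (CR (d / 2) ltac:(lra)) as [e1 [He1 H1]].
  destruct (CI (d / 2) ltac:(lra)) as [e2 [He2 H2]].
  exists (Rmin e1 e2); split; [now apply Rmin_glb_lt|].
  intros s [Hs1 Hs2]; simpl in *; unfold R_dist in *.
  rewrite <- Im_minus.
  eapply Rle_lt_trans; [apply Im_abs_le|]; apply H.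
  eapply Rle_lt_trans; [apply Cmod_le_abs|].
  rewrite Re_minus, Im_minus.
  assert (A1 := H1 s (conj Hs1 (Rlt_le_trans _ _ _ Hs2 (Rmin_l _ _)))).
  assert (A2 := H2 s (conj Hs1 (Rlt_le_trans _ _ _ Hs2 (Rmin_r _ _)))).
  lra.
Qed.

Lemma ex_Cderive_log_Gamma_seq n f t a : 0 <= Re (f t) -> is_Cderive f t a ->
  exists l, is_Cderive (fun s => log_Gamma_seq n (f s)) t l.
Proof.
  intros Hf Df.
  assert (Hsum : forall m, exists l, is_Cderive (fun s => sum_Clog (f s) m) t l).
  { induction m as [|m [l Hl]].
    - exists (RtoC 0); apply (is_Cderive_const (RtoC 0)).
    - eexists; simpl sum_Clog; apply is_Cderive_plus; [exact Hl|].
      assert (P := pos_INR m).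
      apply is_Cderive_log.
      + apply is_Cderive_plus; [exact Df | apply is_Cderive_const].
      + assert (0 < Re (f t + RtoC (INR m + 1 / 2))%C) by (rewrite Re_add_real; lra).
        apply slit_plane_half; [lra | now apply Re_pos_neq_0]. }
  destruct (Hsum (S n)) as [l Hl].
  eexists; unfold log_Gamma_seq; apply is_Cderive_minus; [|exact Hl].
  apply is_Cderive_plus; [apply is_Cderive_const|].
  apply is_Cderive_mult; [|apply is_Cderive_const].
  apply is_Cderive_plus; [exact Df | apply is_Cderive_const].
Qed.

Lemma Im_log_Gamma_seq_real n x : 0 <= x -> Im (log_Gamma_seq n (RtoC x)) = 0.
Proof.
  intros Hx.
  assert (H : forall m, Im (sum_Clog (RtoC x) m) = 0).
  { induction m as [|m IH]; [reflexivity|].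
    assert (P := pos_INR m).
    simpl sum_Clog; rewrite <- RtoC_plus, Clog_RtoC, Im_plus, IH by lra.
    rewrite Im_RtoC; ring. }
  unfold log_Gamma_seq.
  rewrite Im_minus, H, Im_plus, Im_mult, Im_plus, !Im_RtoC; ring.
Qed.

(** Here 6 is any number below 2 PI. *)
Lemma cos_eq_1_small x : cos x = 1 -> -6 < x < 6 -> x = 0.
Proof.
  intros H Hx.
  assert (P := PI2_3_2); assert (P4 := PI_4).
  assert (S2 : sin (x / 2) = 0).
  { assert (E := cos_2a_sin (x / 2)); replace (2 * (x / 2)) with x in E by field.
    rewrite H in E; nra. }
  destruct (Rtotal_order x 0) as [A|[A|A]]; [| assumption |].
  - assert (B := sin_gt_0 (- (x / 2))); rewrite sin_neg in B; lra.
  - assert (B := sin_gt_0 (x / 2)); lra.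
Qed.

(** The threshold 2 is any number between 1 and 2 PI - 1: a function at distance less than
    1 from the multiples of 2 PI cannot take it. *)
Lemma ivt_below_2 (h : R -> R) :
  (forall t, 0 <= t <= 1 -> continuity_pt h t) -> h 0 = 0 ->
  (forall t, 0 <= t <= 1 -> h t <> 2) -> h 1 < 2.
Proof.
  intros Hc H0 Hn; apply Rnot_le_lt; intros H1.
  assert (Hne := Hn 1 ltac:(lra)).
  destruct (IVT_interv (fun t => h t - 2) 0 1) as [t [Ht E]].
  - intros t Ht; apply continuity_pt_minus; [now apply Hc|].
    apply continuity_pt_const; intros ? ?; reflexivity.
  - lra.
  - lra.
  - lra.
  - apply (Hn t Ht); lra.
Qed.

(** Both sides have exponential Gamma (z + 1/2), so they differ by a multiple of 2 PI i,
    and the multiple has to be shown to be 0. Along the segment from 1 to z, the function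
    h compares L with the logarithm of a Gauss product of a single large index n, at
    distance less than 1 from the expansion on the whole segment. Thus h is continuous,
    vanishes at the real point 1, and stays within 1 of the multiples of 2 PI: it cannot
    leave (-2, 2). Comparing with a continuous finite product spares a proof that the
    expansion itself is continuous in z. *)
Lemma lnGamma_expansion (L : C -> C) k z : is_lnGamma L ->
  (1 <= k)%nat -> 0 <= Re z -> z <> 0 ->
  exists l, Cmod l <= remainder_bound k z /\ L (z + RtoC (1 / 2))%C = (stirling_expansion k z + l)%C.
Proof.
  intros [HD [HE HR]] Hk Hz Hz0.
  set (f := fun t : R => (RtoC 1 + RtoC t * (z - RtoC 1))%C).
  assert (Ef : forall t, f t = (RtoC (1 - t) + RtoC t * z)%C)
    by (intros t; unfold f; rewrite RtoC_minus; ring).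
  assert (Hf : forall t, 0 <= t <= 1 ->
     0 <= Re (f t) /\ f t <> 0 /\ Cmod (f t) <= 1 + Cmod z).
  { intros t Ht; split; [|split].
    - rewrite Ef, Re_plus, Re_mult, !Re_RtoC, Im_RtoC; nra.
    - destruct (Req_dec t 1) as [->|Ht1].
      + rewrite Ef; replace (1 - 1) with 0 by ring.
        replace (RtoC 0 + RtoC 1 * z)%C with z by ring; exact Hz0.
      + apply Re_pos_neq_0; rewrite Ef, Re_plus, Re_mult, !Re_RtoC, Im_RtoC.
        assert (0 <= t * Re z) by (apply Rmult_le_pos; lra); lra.
    - rewrite Ef; eapply Rle_trans; [apply Cmod_triangle|].
      rewrite Cmod_mult, !Cmod_R, !Rabs_pos_eq by lra.
      assert (P := Cmod_ge_0 z); nra. }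
  destruct (log_Gamma_seq_uniform k (1 + Cmod z) Hk) as [e [He H]].
  assert (HF : forall t, 0 <= t <= 1 -> exists l, Cmod l <= remainder_bound k (f t) /\
     (forall n, (1 <= n)%nat ->
        Cmod (log_Gamma_seq n (f t) - (stirling_expansion k (f t) + l)) <= e n) /\
     Re (L (f t + RtoC (1 / 2)))%C = Re (stirling_expansion k (f t) + l)%C /\
     cos (Im (L (f t + RtoC (1 / 2)))%C - Im (stirling_expansion k (f t) + l)%C) = 1).
  { intros t Ht; destruct (Hf t Ht) as [A [B D]].
    destruct (H (f t) A B D) as [l [Hl Hn]].
    exists l; split; [exact Hl|]; split; [exact Hn|].
    apply Cexp_eq; rewrite HE.
    - now apply Cexp_lim_CGamma with e.
    - assert (0 < Re (f t + RtoC (1 / 2))%C) by (rewrite Re_add_real; lra).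
      apply slit_plane_half; [lra | now apply Re_pos_neq_0]. }
  apply is_lim_seq_spec in He.
  destruct (He (mkposreal 1 Rlt_0_1)) as [N HN].
  set (n := S N).
  assert (Hen : e n < 1).
  { specialize (HN n ltac:(unfold n; lia)); simpl in HN.
    apply Rabs_def2 in HN; lra. }
  set (h := fun t => Im (L (f t + RtoC (1 / 2)))%C - Im (log_Gamma_seq n (f t))).
  assert (Df : forall t, is_Cderive f t (z - RtoC 1)%C) by (intros t; apply is_Cderive_line).
  assert (Hh : forall t, 0 <= t <= 1 -> continuity_pt h t).
  { intros t Ht; destruct (Hf t Ht) as [A _].
    apply continuity_pt_minus.
    - eapply (Im_path_continuity L (fun s => (f s + RtoC (1 / 2))%C)).
      + apply HD.
        assert (0 < Re (f t + RtoC (1 / 2))%C) by (rewrite Re_add_real; lra).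
        apply slit_plane_half; [lra | now apply Re_pos_neq_0].
      + apply is_Cderive_plus; [apply Df | apply is_Cderive_const].
    - destruct (ex_Cderive_log_Gamma_seq n f t _ A (Df t)) as [l Hl].
      apply (is_Cderive_continuity _ _ _ Hl). }
  assert (Hh0 : h 0 = 0).
  { unfold h; replace (f 0) with (RtoC 1) by (unfold f; ring).
    rewrite Im_log_Gamma_seq_real, <- RtoC_plus by lra.
    destruct (HR (1 + 1 / 2) ltac:(lra)) as [-> _]; ring. }
  assert (Hclose : forall t, 0 <= t <= 1 -> exists d, cos d = 1 /\ -1 < h t - d < 1).
  { intros t Ht; destruct (HF t Ht) as [l [_ [Hn [_ Hcos]]]].
    eexists; split; [exact Hcos|].
    specialize (Hn n ltac:(unfold n; lia)).
    assert (A := Im_abs_le (log_Gamma_seq n (f t) - (stirling_expansion k (f t) + l))).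
    rewrite Im_minus in A; unfold h.
    assert (B := Rle_lt_trans _ _ _ (Rle_trans _ _ _ A Hn) Hen).
    apply Rabs_def2 in B; lra. }
  assert (Hne : forall t, 0 <= t <= 1 -> h t <> 2 /\ h t <> -2).
  { intros t Ht; destruct (Hclose t Ht) as [d [Hd Hdt]].
    split; intros E; rewrite E in Hdt; apply cos_eq_1_small in Hd; lra. }
  assert (U : h 1 < 2) by (apply ivt_below_2; [exact Hh | exact Hh0 | intros; now apply Hne]).
  assert (D : - h 1 < 2).
  { apply (ivt_below_2 (fun t => - h t)).
    - intros t Ht; now apply continuity_pt_opp, Hh.
    - rewrite Hh0; ring.
    - intros t Ht E; apply (proj2 (Hne t Ht)); lra. }
  assert (E1 : f 1 = z) by (unfold f; ring).
  destruct (HF 1 ltac:(lra)) as [l [Hl [Hn [HRe HIm]]]].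
  rewrite E1 in Hl, Hn, HRe, HIm; exists l; split; [exact Hl|].
  apply Ceq; [exact HRe|].
  specialize (Hn n ltac:(unfold n; lia)).
  assert (A := Im_abs_le (log_Gamma_seq n z - (stirling_expansion k z + l))).
  rewrite Im_minus in A.
  assert (B := Rle_lt_trans _ _ _ (Rle_trans _ _ _ A Hn) Hen).
  apply Rabs_def2 in B.
  unfold h in U, D; rewrite E1 in U, D.
  apply cos_eq_1_small in HIm; lra.
Qed.

(** * The remainder of the expansion *)

(** At 1/2 the Bernoulli polynomials of odd degree vanish. *)
Lemma bernoulli_tail_half k (z : C) : (1 <= k)%nat -> z <> 0 ->
  bernoulli_tail (1 / 2) (/ z) (2 * k - 1) =
  sum_n_m (G := C_AbelianMonoid) (fun j => That j z) 1 k.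
Proof.
  intros Hk Hz.
  assert (Hthat : forall j, (1 <= j)%nat ->
    (RtoC (bern (2 * j) (1 / 2) / (INR (2 * j - 1) * INR (2 * j))) *
       (/ z) ^ (2 * j - 1))%C = That j z).
  { intros j Hj; unfold That.
    assert (A : INR (2 * j) <> 0) by (apply not_0_INR; lia).
    assert (B : INR (2 * j - 1) <> 0) by (apply not_0_INR; lia).
    rewrite Cpow_inv by assumption.
    unfold Rdiv at 1; rewrite RtoC_mult, RtoC_inv, RtoC_mult by (now apply Rmult_integral_contrapositive).
    field; repeat split; try (intros E; apply RtoC_inj in E; auto).
    now apply Cpow_nz. }
  induction k as [|k IH]; [lia|].
  destruct (Nat.eq_dec k 0) as [->|Hk0].
  - rewrite sum_n_n, <- Hthat by lia.
    change (2 * 1 - 1)%nat with 1%nat; change (2 * 1)%nat with 2%nat.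
    simpl bernoulli_tail at 1; simpl INR; ring.
  - rewrite sum_n_Sm, <- IH by lia.
    change plus with Cplus; rewrite <- (Hthat (S k)) by lia.
    replace (2 * S k - 1)%nat with (S (S (2 * k - 1))) by lia.
    change (bernoulli_tail (1 / 2) (/ z) (S (S (2 * k - 1)))) with
      (bernoulli_tail (1 / 2) (/ z) (S (2 * k - 1)) +
       RtoC (bern (S (S (S (2 * k - 1)))) (1 / 2) /
         (INR (S (S (2 * k - 1))) * INR (S (S (S (2 * k - 1)))))) * (/ z) ^ S (S (2 * k - 1)))%C.
    replace (S (S (S (2 * k - 1)))) with (2 * S k)%nat by lia.
    change (bernoulli_tail (1 / 2) (/ z) (S (2 * k - 1))) with
      (bernoulli_tail (1 / 2) (/ z) (2 * k - 1) +
       RtoC (bern (S (S (2 * k - 1))) (1 / 2) /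
         (INR (S (2 * k - 1)) * INR (S (S (2 * k - 1))))) * (/ z) ^ S (2 * k - 1))%C.
    replace (bern (S (S (2 * k - 1))) (1 / 2)) with 0.
    + rewrite Rdiv_0_l; ring.
    + replace (S (S (2 * k - 1))) with (2 * k + 1)%nat by lia; now rewrite bern_half_odd.
Qed.

Lemma Rhat_expansion (L : C -> C) k (z l : C) : (1 <= k)%nat -> z <> 0 ->
  L (z + RtoC (1 / 2))%C = (stirling_expansion k z + l)%C -> Rhat L (k + 1) z = l.
Proof.
  intros Hk Hz E; unfold Rhat; rewrite E.
  replace (k + 1 - 1)%nat with k by lia.
  rewrite <- bernoulli_tail_half by assumption.
  assert (P := PI_RGT_0); rewrite Clog_RtoC by lra.
  unfold stirling_expansion, em_primitive; rewrite RtoC_mult.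
  replace (1 / 2 - 1 / 2) with 0 by ring; ring.
Qed.

(** The factor eta is the ratio of |B_2k(0)| to |B_2k(1/2)|. *)
Lemma remainder_bound_That k (z : C) : (1 <= k)%nat -> z <> 0 ->
  0 < Cmod (That k z) /\
  remainder_bound k z / Cmod (That k z) = eta k * (INR k * PI * wallis k).
Proof.
  intros Hk Hz.
  assert (Hr := proj1 (Cmod_gt_0 z) Hz).
  assert (Hp : 0 < Cmod z ^ (2 * k - 1)) by now apply pow_lt.
  assert (HB : 0 < Rabs (bern (2 * k) 0)) by now apply Rabs_pos_lt, bern_even_0_neq.
  assert (H2 := two_pow_ge k Hk).
  assert (Hk1 : 1 <= INR k) by now apply INR_ge_1.
  assert (HT : Cmod (That k z) =
    (1 - 2 / 2 ^ (2 * k)) * Rabs (bern (2 * k) 0) /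
      (2 * INR k * (2 * INR k - 1) * Cmod z ^ (2 * k - 1))).
  { unfold That; rewrite minus_INR, mult_INR by lia.
    change (INR 2) with 2; change (INR 1) with 1.
    assert (N : forall x : R, 0 < x -> RtoC x <> 0)
      by (intros x Hx E'; apply RtoC_inj in E'; lra).
    rewrite Cmod_div, !Cmod_mult, Cmod_pow, !Cmod_R, !(Rabs_pos_eq (2 * INR k - _)),
      (Rabs_pos_eq (2 * INR k)), bern_half, Rabs_mult, Rabs_Ropp, (Rabs_pos_eq (1 - _)) by
      (try lra; repeat apply Cmult_neq_0; try (apply N; lra); now apply Cpow_nz).
    reflexivity. }
  rewrite HT, eta_pow by assumption; split.
  - apply Rdiv_lt_0_compat; repeat apply Rmult_lt_0_compat; lra.
  - unfold remainder_bound.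
    destruct k as [|m]; [lia|].
    replace (S m - 1)%nat with m by lia.
    simpl wallis; rewrite mult_INR; change (INR 2) with 2.
    rewrite S_INR in *; assert (0 <= INR m) by apply pos_INR.
    set (w := 2 / 2 ^ (2 * S m)) in *.
    set (p := Cmod z ^ (2 * S m - 1)) in *.
    field; repeat split; lra.
Qed.

Theorem corollary2 :
  forall (lnGamma : C -> C), is_lnGamma lnGamma ->
  forall (k : nat) (z : C),
    (1 <= k)%nat -> (0 <= Re z)%R -> z <> RtoC 0 ->
    (Cmod (Rhat lnGamma (k + 1) z / That k z)%C < eta k * sqrt (PI * INR k))%R.
Proof.
  intros L HL k z Hk Hz Hz0.
  destruct (lnGamma_expansion L k z HL Hk Hz Hz0) as [l [Hl E]].
  rewrite (Rhat_expansion L k z l Hk Hz0 E).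
  destruct (remainder_bound_That k z Hk Hz0) as [HT ET].
  rewrite Cmod_div by now apply Cmod_gt_0.
  apply Rle_lt_trans with (remainder_bound k z / Cmod (That k z)).
  - apply Rmult_le_compat_r; [left; now apply Rinv_0_lt_compat | exact Hl].
  - rewrite ET; apply Rmult_lt_compat_l; [|now apply wallis_sqrt_bound].
    rewrite eta_pow by assumption.
    assert (H2 := two_pow_ge k Hk); apply Rinv_0_lt_compat; lra.
Qed.
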